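(* For every $\mathrm{C}^2$ sentence $\varphi$, the sets $\mathrm{spec}(\varphi)$ and $\Pi\text{-}\mathrm{spec}(\varphi)$ are semilinear. Furthermore, each of these spectra can be represented by an existential Presburger arithmetic formula of size doubly exponential in (the length of) $\varphi$.
   Context: Fix a vocabulary $\sigma$ of unary predicates $U_1,\dots,U_n$ and binary predicates $R_1,\dots,R_m$. $\mathrm{C}^2$ is two-variable first-order logic (variables $x,y$) over $\sigma$ extended with counting quantifiers $\exists^{\ge k}y\,\phi$ (''at least $k$ elements $y$ satisfy $\phi$''). A 1-type is a maximal consistent subset of $\{U_i(x),\neg U_i(x): i\le n\}\cup\{R_i(x,x),\neg R_i(x,x): i\le m\}$; fix an enumeration $\pi_1,\dots,\pi_{2^{n+m}}$ of all 1-types. The 1-type cardinality vector of a finite $\sigma$-structure $\mathcal{G}$ is the vector in $\mathbb{N}^{2^{n+m}}$ whose $i$-th entry is the number of elements of $\mathcal{G}$ with 1-type $\pi_i$. $\mathrm{spec}(\varphi)\subseteq\mathbb{N}$ is the set of sizes of finite models of $\varphi$; $\Pi\text{-}\mathrm{spec}(\varphi)$ is the set of 1-type cardinality vectors of finite models of $\varphi$. A set of vectors of natural numbers is semilinear if it is definable in Presburger arithmetic (equivalently, a finite union of linear sets $\{b+\sum_j \lambda_j p_j:\lambda_j\in\mathbb{N}\}$). *)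

(* Defs.v *)
From HB Require Import structures.
From mathcomp Require Import all_boot.

Set Implicit Arguments.
Unset Strict Implicit.
Unset Printing Implicit Defensive.

(* Throughout, the vocabulary has n unary and m binary predicates. *)

(* The two variables: x is false, y is true. *)
Definition var := bool.

Inductive c2 (n m : nat) : Type :=
| CUn (i : 'I_n) (v : var)
| CBin (i : 'I_m) (v w : var)
| CEq (v w : var)
| CNot (phi : c2 n m)
| CAnd (phi psi : c2 n m)
| COr (phi psi : c2 n m)
| CEx (v : var) (phi : c2 n m)
| CAll (v : var) (phi : c2 n m)
| CAtLeast (k : nat) (v : var) (phi : c2 n m).

Arguments CEq {n m} v w.

Fixpoint free (n m : nat) (v : var) (phi : c2 n m) : bool :=
  match phi with
  | CUn _ u => v == u
  | CBin _ u w | CEq u w => (v == u) || (v == w)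
  | CNot p => free v p
  | CAnd p q | COr p q => free v p || free v q
  | CEx u p | CAll u p | CAtLeast _ u p => (v != u) && free v p
  end.

Definition sentence (n m : nat) (phi : c2 n m) : bool :=
  [forall v : var, ~~ free v phi].

(* Number of symbols, parentheses ignored; the threshold k of a counting
   quantifier is a numeral in binary. *)
Fixpoint c2_length (n m : nat) (phi : c2 n m) : nat :=
  match phi with
  | CUn _ _ => 2
  | CBin _ _ _ | CEq _ _ => 3
  | CNot p => (c2_length p).+1
  | CAnd p q | COr p q => (c2_length p + c2_length q).+1
  | CEx _ p | CAll _ p => (c2_length p).+2
  | CAtLeast k _ p => (up_log 2 k.+1 + c2_length p).+2
  end.

Record structure (n m : nat) := Structure {
  dom :> finType;
  un : 'I_n -> pred dom;
  bin : 'I_m -> rel dom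
}.

Definition upd (T : Type) (e : var -> T) (v : var) (a : T) : var -> T :=
  fun w => if w == v then a else e w.

Fixpoint sat (n m : nat) (G : structure n m) (e : var -> G) (phi : c2 n m)
    : bool :=
  match phi with
  | CUn i v => un i (e v)
  | CBin i v w => bin i (e v) (e w)
  | CEq v w => e v == e w
  | CNot p => ~~ sat e p
  | CAnd p q => sat e p && sat e q
  | COr p q => sat e p || sat e q
  | CEx v p => [exists a : G, sat (upd e v a) p]
  | CAll v p => [forall a : G, sat (upd e v a) p]
  | CAtLeast k v p => k <= #|[set a : G | sat (upd e v a) p]|
  end.

(* Structures have non-empty domains, so for a sentence the quantification
   over assignments is never vacuous. *)
Definition finite_model (n m : nat) (G : structure n m) (phi : c2 n m) : Prop :=
  0 < #|G| /\ forall e : var -> G, sat e phi.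

(* A literal in the variable x: (inl i, b) is U_i(x) and (inr i, b) is
   R_i(x,x), negated when b is false. *)
Definition literal (n m : nat) : finType := (('I_n + 'I_m) * bool)%type.

Definition consistent (n m : nat) (S : {set literal n m}) : bool :=
  [forall a : ('I_n + 'I_m)%type, ~~ (((a, true) \in S) && ((a, false) \in S))].

Definition onetype (n m : nat) (t : {set literal n m}) : bool :=
  maxset (@consistent n m) t.

Definition literal_holds (n m : nat) (G : structure n m) (a : G)
    (l : literal n m) : bool :=
  let: (p, b) := l in
  match p with inl i => un i a == b | inr i => bin i a a == b end.

Definition onetype_of (n m : nat) (G : structure n m) (a : G)
    : {set literal n m} :=
  [set l | literal_holds a l].

Definition onetype_enum (n m : nat) (pi : 'I_(2 ^ (n + m)) -> {set literal n m})
    : Prop :=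
  injective pi /\ forall t, onetype t <-> exists i, pi i = t.

Definition cardinality_vector (n m : nat)
    (pi : 'I_(2 ^ (n + m)) -> {set literal n m}) (G : structure n m)
    (i : 'I_(2 ^ (n + m))) : nat :=
  #|[set a : G | onetype_of a == pi i]|.

Definition spec (n m : nat) (phi : c2 n m) (N : nat) : Prop :=
  exists G : structure n m, finite_model G phi /\ #|G| = N.

Definition Pi_spec (n m : nat) (pi : 'I_(2 ^ (n + m)) -> {set literal n m})
    (phi : c2 n m) (v : 'I_(2 ^ (n + m)) -> nat) : Prop :=
  exists G : structure n m,
    finite_model G phi /\ forall i, cardinality_vector pi G i = v i.

(* Presburger arithmetic, well-scoped: the free variables of a formula of type
   pform k are indexed by 'I_k, and a quantifier binds variable ord0 of its
   body, the others being shifted by one. *)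
Inductive pterm (k : nat) : Type :=
| TVar (i : 'I_k)
| TZero
| TOne
| TAdd (s t : pterm k).

Inductive pform : nat -> Type :=
| PEq k (s t : pterm k) : pform k
| PLt k (s t : pterm k) : pform k
| PNot k (f : pform k) : pform k
| PAnd k (f g : pform k) : pform k
| POr k (f g : pform k) : pform k
| PEx k (f : pform k.+1) : pform k
| PAll k (f : pform k.+1) : pform k.

Fixpoint teval (k : nat) (v : 'I_k -> nat) (t : pterm k) : nat :=
  match t with
  | TVar i => v i
  | TZero => 0
  | TOne => 1
  | TAdd s t => teval v s + teval v t
  end.

Definition vcons (k : nat) (a : nat) (v : 'I_k -> nat) : 'I_k.+1 -> nat :=
  fun i => if unlift ord0 i is Some j then v j else a.

Fixpoint holds (k : nat) (f : pform k) : ('I_k -> nat) -> Prop :=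
  match f in pform k return ('I_k -> nat) -> Prop with
  | PEq _ s t => fun v => teval v s = teval v t
  | PLt _ s t => fun v => teval v s < teval v t
  | PNot _ f => fun v => ~ holds f v
  | PAnd _ f g => fun v => holds f v /\ holds g v
  | POr _ f g => fun v => holds f v \/ holds g v
  | PEx _ f => fun v => exists a, holds f (vcons a v)
  | PAll _ f => fun v => forall a, holds f (vcons a v)
  end.

Fixpoint quantifier_free (k : nat) (f : pform k) : bool :=
  match f with
  | PEq _ _ _ | PLt _ _ _ => true
  | PNot _ f => quantifier_free f
  | PAnd _ f g | POr _ f g => quantifier_free f && quantifier_free g
  | PEx _ _ | PAll _ _ => false
  end.

Fixpoint existential (k : nat) (f : pform k) : bool :=
  match f with
  | PEx _ f => existential f
  | f => quantifier_free f
  end.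

Fixpoint tsize (k : nat) (t : pterm k) : nat :=
  match t with
  | TVar _ | TZero | TOne => 1
  | TAdd s t => (tsize s + tsize t).+1
  end.

(* Each quantifier counts for two symbols: itself and its variable. *)
Fixpoint psize (k : nat) (f : pform k) : nat :=
  match f with
  | PEq _ s t | PLt _ s t => (tsize s + tsize t).+1
  | PNot _ f => (psize f).+1
  | PAnd _ f g | POr _ f g => (psize f + psize g).+1
  | PEx _ f | PAll _ f => (psize f).+2
  end.

Definition defines (k : nat) (f : pform k) (S : ('I_k -> nat) -> Prop) : Prop :=
  forall v, holds f v <-> S v.

Definition semilinear (k : nat) (S : ('I_k -> nat) -> Prop) : Prop :=
  exists f : pform k, defines f S.

(* A set of naturals as a set of vectors of dimension one. *)
Definition as_vectors (S : nat -> Prop) (v : 'I_1 -> nat) : Prop := S (v ord0).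

(* For L > 0 every polynomial in L is below c * L ^ c for some c, so
   "s is doubly exponential in L" means: s <= doubly_exp c L for a constant c. *)
Definition doubly_exp (c L : nat) : nat := 2 ^ (2 ^ (c * L ^ c)).

(* Main.v *)
(** Each quantified subformula, having at most one free variable, becomes a
unary label.  A model is then a vertex-coloured, edge-coloured complete graph in
which the label of a vertex [a] says whether at least [k] edges at [a] are of a
certain kind.  Let every vertex mark, for each label, [k] such edges when there
are at least [k] and all of them otherwise.  At most [D] edges are marked at
each vertex, with [D] the sum of the thresholds [k], so that [D + D^2 + 1]
colours suffice to give distinct colours to the ends of a mutually marked edge
and to the mutual partners of any vertex (Pratt-Hartmann's chromatic
structures).  Vertices whose colour class is small are "kings"; there are
boundedly many of them.  The star of another vertex consists of its colour, its
edges to the kings, and its marked edges.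

Given the kings, the numbers [w] of vertices of each star satisfy linear
constraints: for each mutual edge type the two sides have equally many ends,
large classes stay large, and the kings see the right number of edges.
Conversely a solution of these constraints is realized by a structure with
exactly these numbers of stars.  A mutual edge type is a perfect matching
between two classes; a one-way mark is sent from one third of a class to the
next third, in cyclic order, which leaves enough room because classes are large;
every other edge gets a type that is irrelevant for the constraints.  The
spectrum is therefore a finite union of projections of these solution sets. *)

Require Import Defs.
From HB Require Import structures.
From mathcomp Require Import all_boot.
From mathcomp Require Import zify.

Set Implicit Arguments.
Unset Strict Implicit.
Unset Printing Implicit Defensive.

(** * Colouring and matching *)

(** Vertices are coloured one after another: the at most [d] neighbours of the next vertex leave one
    of the [d.+1] colours free. *)
Lemma greedy_colouring (V : finType) (r : rel V) (d : nat) :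
  symmetric r -> (forall a, #|[set b | r a b]| <= d) ->
  exists chi : V -> 'I_d.+1, forall a b, a != b -> r a b -> chi a != chi b.
Proof.
move=> rsym rdeg.
suff [chi chiP] : exists chi : V -> 'I_d.+1, forall a b, a \in enum V ->
    b \in enum V -> a != b -> r a b -> chi a != chi b.
  by exists chi => a b; apply: chiP; rewrite mem_enum.
elim: (enum V) => [|x s [chi chiP]]; first by exists (fun=> ord0).
case xs: (x \in s).
  by exists chi => a b; rewrite !inE => /predU1P[->|sa] /predU1P[->|sb]; apply: chiP.
have [c cP] : exists c, c \notin chi @: [set b | r x b].
  apply/existsP; rewrite -negb_forall; apply/negP => /forallP all_in.
  have : #|'I_d.+1| <= #|chi @: [set b | r x b]|.
    by apply/subset_leq_card/subsetP => c _; apply: all_in.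
  by rewrite card_ord leqNgt ltnS (leq_trans (leq_imset_card _ _) (rdeg x)).
have avoid b : r x b -> chi b != c.
  by move=> rxb; apply: contraNneq cP => <-; apply: imset_f; rewrite inE.
exists (fun a => if a == x then c else chi a) => a b.
rewrite !inE; case: eqVneq => [->|_] /= sa; case: eqVneq => [->|_] /= sb //.
- by move=> _ /avoid; rewrite eq_sym.
- by rewrite rsym => _ /avoid.
- exact: chiP.
Qed.

(** The positions [3 * i + g] with [i < n] all lie below [3 * n], hence inside [enum A]. *)
Lemma card_residue_class (V : finType) (A : {set V}) (n g : nat) :
  3 * n <= #|A| -> g < 3 ->
  n <= #|[set b in A | index b (enum A) %% 3 == g]|.
Proof.
move=> An g3; case: (posnP n) => [->//|n0].
have [x0 _] : exists x0, x0 \in A by apply/set0Pn; rewrite -card_gt0; lia.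
pose f (i : 'I_n) := nth x0 (enum A) (3 * i + g).
have lt_i (i : 'I_n) : 3 * i + g < size (enum A).
  by rewrite -cardE; move: (ltn_ord i); lia.
have f_inj : injective f.
  move=> i j /eqP; rewrite nth_uniq ?lt_i ?enum_uniq // => /eqP ij.
  by apply: val_inj => /=; lia.
rewrite -[leqLHS]card_ord -(card_imset _ f_inj).
apply/subset_leq_card/subsetP => _ /imsetP[i _ ->].
by rewrite inE -mem_enum mem_nth // index_uniq ?enum_uniq //= mulnC modnMDl modn_small.
Qed.

Section Targets.

Variables (B Q E : finType) (inv : E -> E) (D : nat).
Variables (col : B -> Q) (slot : B -> 'I_D -> option (E * Q * bool)).

Definition mutual_slot (q q' : Q) (e : E) : {set B} :=
  [set a | (col a == q) && [exists d, slot a d == Some (e, q', true)]].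

Hypothesis invK : involutive inv.
Hypothesis slot_mutual_col :
  forall a d e q, slot a d = Some (e, q, true) -> q != col a.
Hypothesis slot_mutual_uniq : forall a d d' e e' q,
  slot a d = Some (e, q, true) -> slot a d' = Some (e', q, true) -> d = d'.
Hypothesis card_mutual_slot :
  forall q q' e, #|mutual_slot q q' e| = #|mutual_slot q' q (inv e)|.
Hypothesis slot_class_large : forall a d e q i,
  slot a d = Some (e, q, i) -> 3 * (2 * D).+1 <= #|[set b | col b == q]|.

(** The perfect matching: elements at the same position of the two enumerations are joined. Both
    sets have the same size, so the default [a] is never reached from a mutual slot. *)
Let partner (a : B) (e : E) (q : Q) : B :=
  nth a (enum (mutual_slot q (col a) (inv e))) (index a (enum (mutual_slot (col a) q e))).

Let mem_mutual a d e q :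
  slot a d = Some (e, q, true) -> a \in mutual_slot (col a) q e.
Proof. by move=> ad; rewrite inE eqxx; apply/existsP; exists d; rewrite ad. Qed.

Let partner_mutual a d e q : slot a d = Some (e, q, true) ->
  partner a e q \in mutual_slot q (col a) (inv e).
Proof.
move=> /mem_mutual aX.
by rewrite -mem_enum mem_nth // -cardE -card_mutual_slot cardE index_mem mem_enum.
Qed.

Let partnerK a d e q : slot a d = Some (e, q, true) ->
  partner (partner a e q) (inv e) (col a) = a.
Proof.
move=> ad; have := partner_mutual ad; rewrite inE => /andP[/eqP colb _].
rewrite {1}/partner colb invK /partner index_uniq ?enum_uniq //.
  by rewrite nth_index // mem_enum (mem_mutual ad).
by rewrite -cardE -card_mutual_slot cardE index_mem mem_enum (mem_mutual ad).
Qed.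

Let group (a : B) : nat := index a (enum [set b | col b == col a]) %% 3.

(** Slots that are not mutual contribute the harmless element [a]; as an image of ['I_D] the set has
    at most [D] elements. *)
Let partners (a : B) : {set B} :=
  [set (if slot a d is Some (e, q, true) then partner a e q else a) | d : 'I_D].

Let candidates (a : B) (q : Q) : {set B} :=
  [set b in [set b | col b == q] | group b == (group a).+1 %% 3] :\: partners a.

(** Each third of the class has at least [2 * D + 1] elements and at most [D] of them are partners,
    so the [d]-th candidate exists for every slot [d]. *)
Let card_candidates a d e q i :
  slot a d = Some (e, q, i) -> D <= #|candidates a q|.
Proof.
move=> /slot_class_large large.
have group_large : (2 * D).+1 <=
    #|[set b in [set b | col b == q] | group b == (group a).+1 %% 3]|.
  apply: leq_trans (card_residue_class large (ltn_pmod (group a).+1 (isT : 0 < 3))) _.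
  apply/subset_leq_card/subsetP => b; rewrite !inE => /andP[/eqP colb].
  by rewrite /group colb eqxx => ->.
have few : #|partners a| <= D.
  by rewrite -[leqRHS]card_ord leq_imset_card.
rewrite cardsD.
have := subset_leq_card (subsetIr [set b in [set b | col b == q] |
  group b == (group a).+1 %% 3] (partners a)).
lia.
Qed.

Let tgt (a : B) (d : 'I_D) : B :=
  match slot a d with
  | Some (e, q, true) => partner a e q
  | Some (e, q, false) => nth a (enum (candidates a q)) d
  | None => a
  end.

Let tgt_mutual a d e q : slot a d = Some (e, q, true) -> tgt a d = partner a e q.
Proof. by rewrite /tgt => ->. Qed.

Let tgt_candidate a d e q :
  slot a d = Some (e, q, false) -> tgt a d \in candidates a q.
Proof.
move=> ad; rewrite /tgt ad -mem_enum mem_nth // -cardE.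
exact: leq_trans (ltn_ord d) (card_candidates ad).
Qed.

Let tgt_col a d e q i : slot a d = Some (e, q, i) -> col (tgt a d) = q.
Proof.
case: i => ad; last by move: (tgt_candidate ad); rewrite !inE => /and3P[_ /eqP].
by rewrite (tgt_mutual ad); move: (partner_mutual ad); rewrite inE => /andP[/eqP].
Qed.

Let tgt_inv a d e q : slot a d = Some (e, q, true) ->
  exists2 d', slot (tgt a d) d' = Some (inv e, col a, true) & tgt (tgt a d) d' = a.
Proof.
move=> ad; rewrite (tgt_mutual ad).
have := partner_mutual ad; rewrite inE => /andP[_ /existsP[d' /eqP bd']].
by exists d' => //; rewrite (tgt_mutual bd') (partnerK ad).
Qed.

Let tgt_group a d e q :
  slot a d = Some (e, q, false) -> group (tgt a d) = (group a).+1 %% 3.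
Proof. by move=> /tgt_candidate; rewrite !inE => /and3P[_ _ /eqP]. Qed.

Let tgt_partners a d e q :
  slot a d = Some (e, q, false) -> tgt a d \notin partners a.
Proof. by move=> /tgt_candidate; rewrite inE => /andP[]. Qed.

Let mem_partners a d e q : slot a d = Some (e, q, true) -> tgt a d \in partners a.
Proof. by move=> ad; apply/imsetP; exists d; rewrite // (tgt_mutual ad) ad. Qed.

Let group_lt a : group a < 3. Proof. by rewrite ltn_mod. Qed.

Let tgt_neq a d : slot a d != None -> tgt a d != a.
Proof.
case ad: (slot a d) => [[[e q] [|]]|] // _.
  by apply: contraNneq (slot_mutual_col ad) => tgt_a; rewrite -(tgt_col ad) tgt_a.
apply/eqP => tgt_a; have := tgt_group ad.
by rewrite tgt_a; move: (group_lt a); lia.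
Qed.

(** Equal targets have equal colours. Two mutual slots then coincide by uniqueness, two one-way
    slots because slot [d] takes the [d]-th candidate, and a mixed pair is impossible since
    candidates avoid partners. *)
Let tgt_inj a d d' :
  slot a d != None -> slot a d' != None -> tgt a d = tgt a d' -> d = d'.
Proof.
case ad: (slot a d) => [[[e q] i]|] // _; case ad': (slot a d') => [[[e' q'] i']|] // _.
move=> tgt_eq; have := tgt_col ad'; rewrite -tgt_eq (tgt_col ad) => qq'; subst q'.
case: i i' ad ad' => [] [] ad ad'.
- exact: slot_mutual_uniq ad ad'.
- by case/negP: (tgt_partners ad'); rewrite -tgt_eq (mem_partners ad).
- by case/negP: (tgt_partners ad); rewrite tgt_eq (mem_partners ad').
- have lt_size (c : 'I_D) : c < size (enum (candidates a q)).
    by rewrite -cardE; apply: leq_trans (ltn_ord c) (card_candidates ad).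
  move: tgt_eq; rewrite /tgt ad ad' => /eqP.
  by rewrite nth_uniq ?enum_uniq ?lt_size // => /eqP/val_inj.
Qed.

(* A one-way message goes from a third of its class to the next third, in
   cyclic order, so it is never answered by another one-way message. *)
Lemma slot_targets : exists tgt : B -> 'I_D -> B,
  [/\ forall a d e q i, slot a d = Some (e, q, i) -> col (tgt a d) = q,
      forall a d, slot a d != None -> tgt a d != a,
      forall a d d', slot a d != None -> slot a d' != None ->
        tgt a d = tgt a d' -> d = d',
      forall a d e q, slot a d = Some (e, q, true) ->
        exists2 d', slot (tgt a d) d' = Some (inv e, col a, true) &
          tgt (tgt a d) d' = a
    & forall a d e q, slot a d = Some (e, q, false) ->
        forall d', slot (tgt a d) d' != None -> tgt (tgt a d) d' != a].
Proof.
exists tgt; split; [exact: tgt_col|exact: tgt_neq|exact: tgt_inj|exact: tgt_inv|].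
move=> a d e q ad d'; case bd': (slot _ d') => [[[e' q'] [|]]|] // _.
  (* A mutual slot leading back would make the target a partner of [a], and candidates exclude
     partners. *)
  apply/eqP => back; have [d'' ad'' tgt_d''] := tgt_inv bd'.
  case/negP: (tgt_partners ad); rewrite -tgt_d'' back; apply: mem_partners.
  by rewrite -{1}back; exact: ad''.
(* Two one-way steps advance the group by 2 modulo 3, so they cannot return to [a]. *)
apply/eqP => back; have := tgt_group bd'; rewrite back (tgt_group ad).
by move: (group_lt a); lia.
Qed.

End Targets.

(** * From stars to structures *)

Lemma card_set_sum (A B : finType) (P : pred (A + B)) :
  #|[set x | P x]| = #|[set a | P (inl a)]| + #|[set b | P (inr b)]|.
Proof. by rewrite -!sum1dep_card big_sumType. Qed.

Lemma card_set_sig (A : finType) (S P : pred A) :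
  #|[set x : {a | S a} | P (val x)]| = #|[set a | S a && P a]|.
Proof.
rewrite -(card_imset _ val_inj); apply: eq_card => a.
apply/imsetP/idP => [[x]|]; first by rewrite !inE => Px ->; rewrite Px (valP x).
by rewrite inE => /andP[Sa Pa]; exists (exist _ a Sa); rewrite ?inE.
Qed.

Lemma card_set_tag (I : finType) (w : I -> nat) (P : pred I) :
  #|[set x : {i & 'I_(w i)} | P (tag x)]| = \sum_(i | P i) w i.
Proof.
rewrite -sum1dep_card.
rewrite [RHS](eq_bigr (fun i => \sum_(j : 'I_(w i) | true) 1)); last first.
  by move=> i _; rewrite sum1_card card_ord.
rewrite (@sig_big_dep _ _ _ I (fun i => 'I_(w i)) P (fun=> xpredT) (fun _ _ => 1)).
by apply: eq_bigl => x; rewrite andbT.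
Qed.

Section Pairings.

Variables (T E : finType) (inv : E -> E) (l : nat) (thr : 'I_l -> nat).
Variables (lab : 'I_l -> T -> bool) (rel : 'I_l -> T -> E -> T -> bool).
Variables (loop : 'I_l -> T -> bool) (good : pred T).

(** An abstract model. Each label is the truth value of a counting statement, in which [loop j]
    decides whether the vertex is its own witness and [rel j] which other vertices are witnesses. *)
Definition valid (V : finType) (tau : V -> T) (eta : V -> V -> E) : Prop :=
  [/\ 0 < #|V|,
      forall a b, a != b -> eta b a = inv (eta a b),
      forall a, good (tau a)
    & forall a j, lab j (tau a) =
        (thr j <= loop j (tau a) +
           #|[set b | (b != a) && rel j (tau a) (eta a b) (tau b)]|)].

(* An edge that the source may leave unmarked: it counts for no label that is
   false at the source. *)
Definition quiet (t : T) (e : E) (t' : T) : bool :=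
  [forall j, lab j t || ~~ rel j t e t'].

Definition silent (t : T) (e : E) (t' : T) : bool :=
  quiet t e t' && quiet t' (inv e) t.

Hypothesis invK : involutive inv.

Section Edges.

Variables (B Q : finType) (ty : Q -> T) (D : nat).
Variables (col : B -> Q) (slot : B -> 'I_D -> option (E * Q * bool)).
Variable tgt : B -> 'I_D -> B.
Hypothesis tgt_col :
  forall a d e q i, slot a d = Some (e, q, i) -> col (tgt a d) = q.
Hypothesis tgt_neq : forall a d, slot a d != None -> tgt a d != a.
Hypothesis tgt_inj : forall a d d', slot a d != None -> slot a d' != None ->
  tgt a d = tgt a d' -> d = d'.
Hypothesis tgt_mutual : forall a d e q, slot a d = Some (e, q, true) ->
  exists2 d', slot (tgt a d) d' = Some (inv e, col a, true) & tgt (tgt a d) d' = a.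
Hypothesis tgt_oneway : forall a d e q, slot a d = Some (e, q, false) ->
  forall d', slot (tgt a d) d' != None -> tgt (tgt a d) d' != a.
Hypothesis oneway_quiet : forall a d e q,
  slot a d = Some (e, q, false) -> quiet (ty q) (inv e) (ty (col a)).
Hypothesis ex_silent : forall a b, exists e, silent (ty (col a)) e (ty (col b)).

Let mark (a b : B) : option E :=
  if [pick d | (slot a d != None) && (tgt a d == b)] is Some d
  then omap (fun msg => msg.1.1) (slot a d) else None.

Let markP a b e : mark a b = Some e ->
  exists d q i, slot a d = Some (e, q, i) /\ tgt a d = b.
Proof.
rewrite /mark; case: pickP => // d /andP[_ /eqP tgt_d].
by case ad: (slot a d) => [[[e' q] i]|] //= -[<-]; exists d, q, i.
Qed.

Let mark_tgt a d e q i : slot a d = Some (e, q, i) -> mark a (tgt a d) = Some e.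
Proof.
move=> ad; have ad0 : slot a d != None by rewrite ad.
rewrite /mark; case: pickP => [d' /andP[ad'0 /eqP /(tgt_inj ad'0 ad0) ->]|/(_ d)].
  by rewrite ad.
by rewrite ad0 eqxx.
Qed.

(** When both ends mark the edge, [tgt_oneway] makes the mark of [a] mutual. The answering slot of
    [b] carries [inv e], and by [tgt_inj] no other slot of [b] leads to [a]. *)
Let mark_sym a b e e' : mark a b = Some e -> mark b a = Some e' -> e' = inv e.
Proof.
move=> /markP[d [q [i [ad <-]]]] back.
have [d1 [q1 [i1 [bd1 tgt_d1]]]] := markP back.
have bd10 : slot (tgt a d) d1 != None by rewrite bd1.
case: i ad => ad; last by case/eqP: (tgt_oneway ad bd10).
have [d2 bd2 tgt_d2] := tgt_mutual ad.
have d12 : d1 = d2 by apply: (tgt_inj bd10); rewrite ?bd2 // tgt_d2.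
by move: bd1; rewrite d12 bd2 => -[->].
Qed.

Let sil (a b : B) : E := xchoose (ex_silent a b).

(** For a pair that neither end marks, the silent type is chosen at the end of smaller [enum_rank],
    so that the two directions are inverse to each other. *)
Let eta (a b : B) : E :=
  match mark a b, mark b a with
  | Some e, _ => e
  | None, Some e => inv e
  | None, None => if enum_rank a < enum_rank b then sil a b else inv (sil b a)
  end.

Let eta_sym a b : a != b -> eta b a = inv (eta a b).
Proof.
rewrite /eta => neq_ab.
case ab: (mark a b) => [e|]; case ba: (mark b a) => [e'|] //.
- by rewrite (mark_sym ab ba).
- have : val (enum_rank a) != val (enum_rank b).
    by rewrite (inj_eq val_inj) (inj_eq enum_rank_inj).
  by case: ltngtP.
Qed.

(** Distinct slots have distinct targets, which gives the lower bound. For a label that is false at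
    [a], every edge not marked by [a] is quiet at [a], so only the slots count. A true label needs
    no upper bound. *)
Lemma edges_of_targets : exists eta : B -> B -> E,
  (forall a b, a != b -> eta b a = inv (eta a b)) /\
  forall a j,
    let slots := [set d | if slot a d is Some (e, q, _)
                          then rel j (ty (col a)) e (ty q) else false] in
    let edges :=
      [set b | (b != a) && rel j (ty (col a)) (eta a b) (ty (col b))] in
    #|slots| <= #|edges| /\ (~~ lab j (ty (col a)) -> #|edges| <= #|slots|).
Proof.
exists eta; split=> // a j; set S := [set d | _]; set N := [set b | _].
have tgt_in d : d \in S -> tgt a d \in N.
  rewrite !inE; case ad: (slot a d) => [[[e q] i]|] // rel_d.
  rewrite tgt_neq ?ad //= (tgt_col ad).
  by rewrite /eta (mark_tgt ad).
have tgt_injS : {in S &, injective (tgt a)}.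
  move=> d d'; rewrite !inE => Sd Sd'; apply: tgt_inj.
    by case: (slot a d) Sd.
  by case: (slot a d') Sd'.
split=> [|unlab].
  rewrite -(card_in_imset tgt_injS); apply/subset_leq_card/subsetP.
  by move=> _ /imsetP[d Sd ->]; apply: tgt_in.
rewrite -(card_in_imset tgt_injS); apply/subset_leq_card/subsetP => b.
rewrite inE /eta => /andP[neq_ba]; case ab: (mark a b) => [e|].
  have [d [q [i [ad tgt_d]]]] := markP ab => rel_e.
  apply/imsetP; exists d => //; rewrite inE ad.
  by move: rel_e; rewrite -tgt_d (tgt_col ad).
have no_rel t' e : quiet (ty (col a)) e t' -> ~~ rel j (ty (col a)) e t'.
  by move=> /forallP/(_ j); rewrite (negPf unlab).
(* An edge marked by [b] but not by [a] is one-way, since a mutual slot of [b] would be answered by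
   a mark of [a]; hence it is quiet at [a]. *)
case ba: (mark b a) => [e|].
  have [d [q [i [bd tgt_d]]]] := markP ba.
  case: i bd => bd; last first.
    by apply: contraTT => _; apply: no_rel; rewrite -tgt_d (tgt_col bd) (oneway_quiet bd).
  have [d'] := tgt_mutual bd; rewrite tgt_d => ad' tgt_d'.
  by move: (mark_tgt ad'); rewrite tgt_d' ab.
have sil_ab x y : silent (ty (col x)) (sil x y) (ty (col y)) by apply: (xchooseP (ex_silent x y)).
apply: contraTT => _; apply: no_rel.
by case: ifP => _; [have := sil_ab a b|have := sil_ab b a] => /andP[].
Qed.

End Edges.

Section Stars.

Variables (C R D : nat).

(* A slot [Some (e, q, i)] is a marked edge of type [e] to a vertex of colour [q];
   [i] tells whether the edge is also marked by the other end. *)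
Definition colour : finType := (T * 'I_C)%type.
Definition star : finType :=
  (colour * {ffun 'I_R -> E} * {ffun 'I_D -> option (E * colour * bool)})%type.
(* The kings, named by ordinals below [R], their types, the edges between them
   (types and edges are junk at absent kings), and the large colour classes. *)
Definition court : finType :=
  ({set 'I_R} * {ffun 'I_R -> T} * {ffun 'I_R * 'I_R -> E} * {set colour})%type.

Definition scol (s : star) : colour := s.1.1.
Definition sedge (s : star) : 'I_R -> E := s.1.2.
Definition slot (s : star) : 'I_D -> option (E * colour * bool) := s.2.
Definition kings (K : court) : {set 'I_R} := K.1.1.1.
Definition ktype (K : court) : 'I_R -> T := K.1.1.2.
Definition kedge (K : court) (b b' : 'I_R) : E := K.1.2 (b, b').
Definition large (K : court) : {set colour} := K.2.

(** The last clause provides a type for the pairs of ordinary vertices that neither end marks. *)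
Definition court_ok (K : court) : bool :=
  [&& [forall b in kings K, [forall b' in kings K,
        (b != b') ==> (kedge K b' b == inv (kedge K b b'))]],
      [forall b in kings K, good (ktype K b)],
      [forall q in large K, good q.1]
    & [forall q in large K, [forall q' in large K,
        [exists e, silent q.1 e q'.1]]]].

Definition mutual (s : star) (e : E) (q : colour) : bool :=
  [exists d, slot s d == Some (e, q, true)].

(** The colouring separates the ends of a mutual edge. A one-way mark is quiet in the reverse
    direction because its target leaves the edge unmarked. *)
Definition slot_ok (K : court) (q0 : colour) (m : option (E * colour * bool)) : bool :=
  if m is Some (e, q, i)
  then (q \in large K) && (if i then q != q0 else quiet q.1 (inv e) q0.1)
  else true.

(** The colouring gives distinct colours to the mutual partners of a vertex, so that colour alone
    identifies the partner. *)
Definition slot_conflict (m m' : option (E * colour * bool)) : bool :=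
  if (m, m') is (Some (_, q, true), Some (_, q', true)) then q == q' else false.

Definition slot_rel (j : 'I_l) (t : T) (m : option (E * colour * bool)) : bool :=
  if m is Some (e, q, _) then rel j t e q.1 else false.

Definition king_count (K : court) (s : star) (j : 'I_l) : nat :=
  #|[set b in kings K | rel j (scol s).1 (sedge s b) (ktype K b)]|.

Definition star_ok (K : court) (s : star) : bool :=
  [&& scol s \in large K,
      [forall d, slot_ok K (scol s) (slot s d)],
      [forall d, [forall d', (d != d') ==> ~~ slot_conflict (slot s d) (slot s d')]]
    & [forall j, lab j (scol s).1 ==
        (thr j <= loop j (scol s).1 + king_count K s j +
           #|[set d | slot_rel j (scol s).1 (slot s d)]|)]].

Definition king_const (K : court) (b : 'I_R) (j : 'I_l) : nat :=
  loop j (ktype K b) +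
  #|[set b' in kings K | (b' != b) && rel j (ktype K b) (kedge K b b') (ktype K b')]|.

Definition king_rel (K : court) (b : 'I_R) (j : 'I_l) (s : star) : bool :=
  rel j (ktype K b) (inv (sedge s b)) (scol s).1.

Record solution (K : court) (w : star -> nat) : Prop := Solution {
  sol_ok : forall s, ~~ star_ok K s -> w s = 0;
  sol_large : forall q, q \in large K ->
    3 * (2 * D).+1 <= \sum_(s | scol s == q) w s;
  sol_mutual : forall q q' e,
    \sum_(s | (scol s == q) && mutual s e q') w s =
    \sum_(s | (scol s == q') && mutual s (inv e) q) w s;
  sol_king : forall b, b \in kings K -> forall j,
    lab j (ktype K b) =
      (thr j <= king_const K b j + \sum_(s | king_rel K b j s) w s);
  sol_nonempty : 0 < #|kings K| + \sum_s w s
}.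

Section Realization.

Variables (K : court) (w : star -> nat).
Hypotheses (Kok : court_ok K) (wP : solution K w).

Let B : finType := {s : star & 'I_(w s)}.

Let B_ok (a : B) : star_ok K (tag a).
Proof.
case: (boolP (star_ok K (tag a))) => // /(sol_ok wP) w0.
by case: a w0 => s [i i_lt] /= w0; rewrite w0 in i_lt.
Qed.

Let slotP (a : B) d e q i : slot (tag a) d = Some (e, q, i) ->
  q \in large K /\ if i then q != scol (tag a) else quiet q.1 (inv e) (scol (tag a)).1.
Proof.
by have /and4P[_ /forallP/(_ d) + _ _] := B_ok a => + ad; rewrite ad => /andP.
Qed.

Let ex_edges : exists eta : B -> B -> E,
  (forall a b, a != b -> eta b a = inv (eta a b)) /\
  forall a j, lab j (scol (tag a)).1 =
    (thr j <= loop j (scol (tag a)).1 + king_count K (tag a) j +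
      #|[set b | (b != a) &&
          rel j (scol (tag a)).1 (eta a b) (scol (tag b)).1]|).
Proof.
pose sl (a : B) := slot (tag a); pose col (a : B) := scol (tag a).
have card_class q : #|[set b : B | col b == q]| = \sum_(s | scol s == q) w s.
  exact: (card_set_tag w (fun s => scol s == q)).
have [|||a d e q i /slotP[Lq _]|] := @slot_targets B colour E inv D col sl invK.
- by move=> a d e q /slotP[].
- move=> a d d' e e' q ad ad'; apply/eqP.
  have /and4P[_ _ /forallP/(_ d)/forallP/(_ d') + _] := B_ok a.
  by move: ad ad'; rewrite /sl => -> ->; rewrite /slot_conflict eqxx implybF negbK.
- move=> q q' e; have := sol_mutual wP q q' e.
  by rewrite -!(card_set_tag w).
- by rewrite card_class (sol_large wP).
move=> tgt [tgt_col tgt_neq tgt_inj tgt_inv tgt_one].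
have [||eta [eta_sym etaP]] := edges_of_targets (ty := fst) tgt_col tgt_neq tgt_inj tgt_inv tgt_one.
- by move=> a d e q /slotP[].
- move=> a b; apply/existsP.
  have /and4P[_ _ _ /forall_inP/(_ (col a)) silP] := Kok.
  have /and4P[La _ _ _] := B_ok a; have /and4P[Lb _ _ _] := B_ok b.
  by move/forall_inP: (silP La); apply.
exists eta; split=> // a j; have [le_SN eq_NS] := etaP a j.
have /and4P[_ _ _ /forallP/(_ j)/eqP labE] := B_ok a.
move: labE le_SN eq_NS; rewrite /slot_rel /col /sl.
set S := #|_|; set N := #|_|; case: (lab j _) => labE le_SN eq_NS.
  by symmetry; apply: leq_trans (esym labE) _; rewrite leq_add2l.
by symmetry; apply: contraFF (esym labE) => /leq_trans -> //; rewrite leq_add2l eq_NS.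
Qed.

Lemma solution_realized : exists (V : finType) (tau : V -> T) (eta : V -> V -> E),
  valid tau eta /\
  forall P : pred T, #|[set a | P (tau a)]| =
    #|[set b in kings K | P (ktype K b)]| + \sum_(s | P (scol s).1) w s.
Proof.
have [etaB [etaB_sym etaBP]] := ex_edges.
pose A := {b : 'I_R | b \in kings K}.
pose tau (x : A + B) := match x with inl b => ktype K (val b) | inr a => (scol (tag a)).1 end.
pose eta (x y : A + B) := match x, y with
  | inl b, inl b' => kedge K (val b) (val b')
  | inl b, inr a => inv (sedge (tag a) (val b))
  | inr a, inl b => sedge (tag a) (val b)
  | inr a, inr a' => etaB a a'
  end.
have countE (P : pred T) : #|[set a | P (tau a)]| =
    #|[set b in kings K | P (ktype K b)]| + \sum_(s | P (scol s).1) w s.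
  rewrite card_set_sum (card_set_sig (mem (kings K)) (fun b => P (ktype K b))).
  by rewrite (card_set_tag w (fun s => P (scol s).1)).
have /and4P[/forall_inP kedge_sym /forall_inP kgood /forall_inP Lgood _] := Kok.
exists (A + B)%type, tau, eta; split=> //; split.
- have -> : #|{: A + B}| = #|[set x | predT (tau x)]|.
    by apply: eq_card => x; rewrite !inE.
  rewrite countE (eq_bigl predT) //.
  by have := sol_nonempty wP; rewrite (_ : [set b in _ | _] = kings K) //;
    apply/setP => b; rewrite inE andbT.
- move=> [b|a] [b'|a'] //= neq; last exact: etaB_sym.
  have /forall_inP/(_ _ (valP b')) := kedge_sym _ (valP b).
  by move=> /implyP/(_ _)/eqP; apply; apply: contra neq => /eqP/val_inj->.
- move=> [b|a] /=; first exact: kgood (valP b).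
  by have /and4P[/Lgood] := B_ok a.
move=> [b|a] j /=.
  rewrite (sol_king wP (valP b)) card_set_sum /= addnA; congr (_ <= _ + _ + _).
    rewrite -(card_set_sig (mem (kings K))
      (fun b' => (b' != val b) && rel j (ktype K (val b)) (kedge K (val b) b') (ktype K b'))).
    by apply: eq_card => b'; rewrite !inE.
  by rewrite -(card_set_tag w (king_rel K (val b) j)).
rewrite etaBP card_set_sum /= addnA; congr (_ <= _ + _ + _).
rewrite /king_count -(card_set_sig (mem (kings K))
  (fun b => rel j (scol (tag a)).1 (sedge (tag a) b) (ktype K b))).
by apply: eq_card => b; rewrite !inE.
Qed.

End Realization.

End Stars.

End Pairings.

(** * From structures to stars *)

Lemma card_bigcup_leq (I V : finType) (P : pred I) (F : I -> {set V}) (n : I -> nat) :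
  (forall i, P i -> #|F i| <= n i) -> #|\bigcup_(i | P i) F i| <= \sum_(i | P i) n i.
Proof.
move=> Fn; elim/big_ind2: _ => //; first by rewrite cards0.
by move=> k S k' S' Sk Sk'; apply: leq_trans (leq_of_leqif (leq_card_setU S S')) (leq_add Sk Sk').
Qed.

Lemma card_fibres (V I : finType) (S : pred V) (f : V -> I) (P : pred I) :
  \sum_(i | P i) #|[set a | S a && (f a == i)]| = #|[set a | S a && P (f a)]|.
Proof.
rewrite -sum1dep_card (partition_big f P) /=; last by move=> a /andP[].
apply: eq_bigr => i Pi; rewrite -sum1dep_card; apply: eq_bigl => a.
by case: eqVneq => [->|]; rewrite ?Pi ?andbT ?andbF.
Qed.

Lemma cardsE_split (V : finType) (S P : pred V) :
  #|[set a | P a]| = #|[set a | S a && P a]| + #|[set a | ~~ S a && P a]|.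
Proof.
by rewrite -(cardsID [set a | S a]); congr (_ + _); apply: eq_card => a; rewrite !inE // andbC.
Qed.

Section StarsOfStructure.

Variables (T E : finType) (inv : E -> E) (l : nat) (thr : 'I_l -> nat).
Variables (lab : 'I_l -> T -> bool) (rel : 'I_l -> T -> E -> T -> bool).
Variables (loop : 'I_l -> T -> bool) (good : pred T).
Variables (V : finType) (tau : V -> T) (eta : V -> V -> E).
Hypothesis V_valid : valid inv thr lab rel loop good tau eta.

(** [D] bounds the marks at a vertex, and [C] is one more than the number of conflicts of a vertex.
    From [Z] elements on a colour class is large. A small class has fewer than [Z] elements, so
    there are at most [R] kings. *)
Let D := \sum_j thr j.
Let C := (D + D * D).+1.
Let Z := 3 * (2 * D).+1.
Let R := #|colour T C| * Z.

Let V_gt0 : 0 < #|V|. Proof. by case: V_valid. Qed.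
Let eta_sym a b : a != b -> eta b a = inv (eta a b).
Proof. by case: V_valid => _ + _ _; apply. Qed.

Let nbrs (a : V) (j : 'I_l) : {set V} :=
  [set b | (b != a) && rel j (tau a) (eta a b) (tau b)].

Let labE a j : lab j (tau a) = (thr j <= loop j (tau a) + #|nbrs a j|).
Proof. by case: V_valid => _ _ _; apply. Qed.

Let few (a : V) (j : 'I_l) : {set V} := [set b in take (thr j) (enum (nbrs a j))].

Let marks (a : V) : {set V} := \bigcup_j few a j.

Let card_few a j : #|few a j| = minn (thr j) #|nbrs a j|.
Proof.
rewrite cardsE (card_uniqP _); first by rewrite size_take_min -cardE.
by rewrite take_uniq // enum_uniq.
Qed.

Let few_sub a j : few a j \subset nbrs a j.
Proof. by apply/subsetP => b; rewrite inE => /mem_take; rewrite mem_enum. Qed.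

Let few_all a j : ~~ lab j (tau a) -> few a j = nbrs a j.
Proof.
rewrite labE -ltnNge => lt_thr; apply/eqP; rewrite eqEcard few_sub card_few.
lia.
Qed.

Let marks_irr a : a \notin marks a.
Proof.
apply/bigcupP => -[j _] /(subsetP (few_sub a j)).
by rewrite inE eqxx.
Qed.

Let card_marks a : #|marks a| <= D.
Proof. by apply: card_bigcup_leq => j _; rewrite card_few geq_minl. Qed.

(** Where a label is false there are fewer counted edges than its threshold, so all of them are
    marked. *)
Let unmarked_quiet a b : a != b -> b \notin marks a ->
  quiet lab rel (tau a) (eta a b) (tau b).
Proof.
move=> neq_ab unmarked; apply/forallP => j; rewrite -implyNb; apply/implyP => unlab.
apply: contra unmarked => rel_ab; apply/bigcupP; exists j => //.
by rewrite few_all // inE eq_sym neq_ab.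
Qed.

(** The marks contain at least [minn (thr j) #|nbrs a j|] counted neighbours, so any number between
    the marked ones and all of them lies on the same side of the threshold. *)
Let lab_between a j n : #|[set b in marks a | b \in nbrs a j]| <= n ->
  n <= #|nbrs a j| -> lab j (tau a) = (thr j <= loop j (tau a) + n).
Proof.
move=> marked_n n_nbrs; rewrite labE; apply/idP/idP => thr_le; last lia.
have : few a j \subset [set b in marks a | b \in nbrs a j].
  apply/subsetP => b few_b; rewrite inE (subsetP (few_sub a j)) // andbT.
  by apply/bigcupP; exists j.
move=> /subset_leq_card; rewrite card_few; lia.
Qed.

Let mut (a b : V) : bool := (b \in marks a) && (a \in marks b).

Let mutC a b : mut a b = mut b a. Proof. exact: andbC. Qed.

Let conflict (a b : V) : bool := mut a b || [exists c, mut a c && mut c b].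

(** A conflict is reached along one or two mutual marks, so a vertex has at most [D + D * D] of
    them. *)
Let ex_colouring : exists chi : V -> 'I_C,
  forall a b, a != b -> conflict a b -> chi a != chi b.
Proof.
apply: greedy_colouring => [a b|a].
  rewrite /conflict mutC; congr (_ || _); apply: eq_existsb => c.
  by rewrite andbC mutC (mutC a).
have sub : [set b | conflict a b] \subset marks a :|: \bigcup_(c in marks a) marks c.
  apply/subsetP => b; rewrite !inE => /orP[/andP[-> //]|/existsP[c /andP[/andP[ac _] /andP[cb _]]]].
  by apply/orP; right; apply/bigcupP; exists c.
apply: leq_trans (subset_leq_card sub) _; apply: leq_trans (leq_of_leqif (leq_card_setU _ _)) _.
apply: leq_add (card_marks a) _.
apply: leq_trans (@card_bigcup_leq _ _ _ _ (fun=> D) (fun c _ => card_marks c)) _.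
by rewrite sum_nat_const leq_mul2r card_marks orbT.
Qed.

Section Coloured.

Variable chi : V -> 'I_C.
Hypothesis chiP : forall a b, a != b -> conflict a b -> chi a != chi b.

Let col (a : V) : colour T C := (tau a, chi a).
Let big (q : colour T C) : bool := Z <= #|[set a | col a == q]|.
Let isking (a : V) : bool := ~~ big (col a).
Let KS : {set V} := [set a | isking a].

Let mut_col a b : mut a b -> col b != col a.
Proof.
move=> ab; rewrite eq_sym; apply: contraTneq isT => -[_ chi_eq].
have neq_ab : a != b.
  by apply: contraTneq ab => ->; rewrite /mut (negPf (marks_irr b)).
by have := chiP neq_ab; rewrite /conflict ab chi_eq eqxx => /(_ isT).
Qed.

Let mut_inj a b b' : mut a b -> mut a b' -> col b = col b' -> b = b'.
Proof.
move=> ab ab' [_ chi_eq]; apply/eqP; apply: contraT => neq_bb'.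
have := chiP neq_bb'; rewrite chi_eq eqxx; apply.
by apply/orP; right; apply/existsP; exists a; rewrite mutC ab.
Qed.

Let card_KS : #|KS| <= R.
Proof.
rewrite -[KS](_ : [set a | predT a && (predC big) (col a)] = _); last first.
  by apply/setP => a; rewrite !inE.
rewrite -card_fibres /R -sum_nat_const big_mkcond.
by apply: leq_sum => q _; case: ifP => //=; rewrite /big -ltnNge => /ltnW.
Qed.

Let ex_king_enum : exists kv : 'I_R -> V,
  {in [set r : 'I_R | r < #|KS|] &, injective kv} /\
  kv @: [set r : 'I_R | r < #|KS|] = KS.
Proof.
have /card_gt0P[a0 _] := V_gt0; exists (fun r => nth a0 (enum KS) r); split.
  move=> r r'; rewrite !inE cardE => lt_r lt_r' /eqP.
  by rewrite nth_uniq ?enum_uniq // => /eqP/val_inj.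
apply/setP => a; apply/imsetP/idP => [[r]|KSa].
  by rewrite inE cardE => lt_r ->; rewrite -mem_enum mem_nth.
have lt_a : index a (enum KS) < #|KS| by rewrite cardE index_mem mem_enum.
exists (Ordinal (leq_trans lt_a card_KS)); first by rewrite inE.
by rewrite nth_index // mem_enum.
Qed.

Section Enumerated.

Variable kv : 'I_R -> V.
Let kset : {set 'I_R} := [set r : 'I_R | r < #|KS|].
Hypotheses (kv_inj : {in kset &, injective kv}) (kv_im : kv @: kset = KS).

Let card_kings (P : pred 'I_R) (P' : pred V) :
  {in kset, forall r, P r = P' (kv r)} ->
  #|[set r in kset | P r]| = #|[set a | isking a && P' a]|.
Proof.
move=> PP'; rewrite -(card_in_imset (f := kv)); last first.
  by move=> r r' /setIdP[kr _] /setIdP[kr' _]; apply: kv_inj.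
apply: eq_card => a; apply/imsetP/idP => [[r /setIdP[kr Pr] ->]|].
  by rewrite inE -PP' // Pr andbT; have := imset_f kv kr; rewrite kv_im inE.
rewrite inE => /andP[ka P'a]; have : a \in KS by rewrite inE.
rewrite -kv_im => /imsetP[r kr a_r]; exists r => //.
by rewrite inE kr PP' // -a_r.
Qed.

Let kv_isking r : r \in kset -> isking (kv r).
Proof. by move=> /(imset_f kv); rewrite kv_im inE. Qed.

(** A star records the edges to all kings separately, so only marks towards other vertices occupy
    slots. *)
Let folk (a : V) : {set V} := marks a :\: KS.

Let card_folk a : #|folk a| <= D.
Proof. by apply: leq_trans (card_marks a); apply: subset_leq_card (subsetDl _ _). Qed.

Let fslot (a : V) (d : 'I_D) : option (E * colour T C * bool) :=
  if d < #|folk a|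
  then let b := nth a (enum (folk a)) d in Some (eta a b, col b, a \in marks b)
  else None.

Let star_of (a : V) : star T E C R D :=
  (col a, [ffun r => eta a (kv r)], [ffun d => fslot a d]).

Let slot_ofE a d : slot (star_of a) d = fslot a d.
Proof. by rewrite /slot ffunE. Qed.

Let fslotP a d m : fslot a d = Some m -> exists b,
  [/\ b \in folk a, b = nth a (enum (folk a)) d, d < size (enum (folk a))
    & m = (eta a b, col b, a \in marks b)].
Proof.
rewrite /fslot cardE; case: ifP => // lt_d [<-].
by exists (nth a (enum (folk a)) d); split => //; rewrite -mem_enum mem_nth.
Qed.

Let fslot_folk a b : b \in folk a ->
  exists2 d, fslot a d = Some (eta a b, col b, a \in marks b) &
    b = nth a (enum (folk a)) d.
Proof.
move=> fb; have lt_b : index b (enum (folk a)) < #|folk a| by rewrite cardE index_mem mem_enum.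
by exists (Ordinal (leq_trans lt_b (card_folk a))); rewrite /fslot /= ?lt_b ?nth_index ?mem_enum.
Qed.

Let mutual_star_of a e q : mutual (star_of a) e q =
  [exists b, [&& b \in folk a, a \in marks b, eta a b == e & col b == q]].
Proof.
apply/existsP/existsP => [[d]|[b /and4P[fb mb /eqP<- /eqP<-]]].
  rewrite slot_ofE => /eqP/fslotP[b [fb _ _ [-> -> mb]]].
  by exists b; rewrite fb -mb !eqxx.
by have [d ad _] := fslot_folk fb; exists d; rewrite slot_ofE ad mb.
Qed.

Let w (s : star T E C R D) : nat := #|[set a | ~~ isking a && (star_of a == s)]|.

Let sum_w (P : pred (star T E C R D)) :
  \sum_(s | P s) w s = #|[set a | ~~ isking a && P (star_of a)]|.
Proof. exact: card_fibres. Qed.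

Let K : court T E C R :=
  (kset, [ffun r => tau (kv r)], [ffun p => eta (kv p.1) (kv p.2)], [set q | big q]).

Let ktypeE r : ktype K r = tau (kv r). Proof. by rewrite /ktype ffunE. Qed.
Let kedgeE r r' : kedge K r r' = eta (kv r) (kv r').
Proof. by rewrite /kedge ffunE. Qed.

Let card_slot_rel a j : #|[set d | slot_rel rel j (tau a) (slot (star_of a) d)]| =
  #|[set b in folk a | b \in nbrs a j]|.
Proof.
rewrite -(card_in_imset (f := fun d : 'I_D => nth a (enum (folk a)) d)); last first.
  move=> d d'; rewrite !inE !slot_ofE.
  case ad: (fslot a d) => [m|] //; have [b [_ _ lt_d _]] := fslotP ad => _.
  case ad': (fslot a d') => [m'|] //; have [b' [_ _ lt_d' _]] := fslotP ad' => _.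
  by move/eqP; rewrite nth_uniq ?enum_uniq // => /eqP/val_inj.
apply: eq_card => b; apply/imsetP/setIdP => [[d + ->]|[fb]].
  rewrite inE slot_ofE; case ad: (fslot a d) => [m|] //.
  have [b' [fb' <- _ ->]] := fslotP ad => /= rel_b'; split=> //.
  rewrite inE rel_b' andbT; apply: contraTneq fb' => ->.
  by rewrite inE (negPf (marks_irr a)) andbF.
rewrite inE => /andP[_ rel_b]; have [d ad b_d] := fslot_folk fb.
by exists d => //; rewrite inE slot_ofE ad.
Qed.

(* Double counting: [X] and [Y] span at least [#|X| * #|Y|] pairs, of which at
   most [(D + 1) * #|X| + D * #|Y|] are marked or on the diagonal. *)
Let big_silent q q' : big q -> big q' -> [exists e, silent inv lab rel q.1 e q'.1].
Proof.
move=> big_q big_q'; set X := [set a | col a == q]; set Y := [set b | col b == q'].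
have X_large : Z <= #|X| := big_q; have Y_large : Z <= #|Y| := big_q'.
suff [a Xa [b Yb [neq_ab ab ba]]] : exists2 a, a \in X &
    exists2 b, b \in Y & [/\ a != b, b \notin marks a & a \notin marks b].
  move: Xa Yb; rewrite !inE => /eqP<- /eqP<-; apply/existsP; exists (eta a b).
  by rewrite /silent -eta_sym // !unmarked_quiet // eq_sym.
have [/exists_inP[a Xa /exists_inP[b Yb /and3P[? ? ?]]]|none] := boolP [exists a in X,
    [exists b in Y, [&& a != b, b \notin marks a & a \notin marks b]]].
  by exists a => //; exists b.
have : \sum_(a in X) \sum_(b in Y) 1 <=
    \sum_(a in X) \sum_(b in Y) ((a == b) + (b \in marks a) + (a \in marks b)).
  apply: leq_sum => a Xa; apply: leq_sum => b Yb.
  move: none; rewrite negb_exists_in => /forall_inP/(_ a Xa).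
  rewrite negb_exists_in => /forall_inP/(_ b Yb).
  by case: (a == b); case: (b \in marks a); case: (a \in marks b).
rewrite (eq_bigr (fun=> #|Y|)); last by move=> a _; rewrite sum1_card.
rewrite sum_nat_const leqNgt => /negP[].
have indic (S : {set V}) (P : pred V) : \sum_(b in S) (P b : nat) = #|[set b in S | P b]|.
  by rewrite -sum1dep_card big_mkcondr; apply: eq_bigr => b _; case: (P b).
have bound1 : \sum_(a in X) \sum_(b in Y) (a == b : nat) <= #|X|.
  rewrite -[leqRHS]sum1_card; apply: leq_sum => a _; rewrite indic.
  rewrite -(cards1 a); apply/subset_leq_card/subsetP => b.
  by rewrite !inE (eq_sym a) => /andP[].
have bound2 (S S' : {set V}) :
    \sum_(a in S) \sum_(b in S') (b \in marks a : nat) <= #|S| * D.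
  rewrite -sum_nat_const; apply: leq_sum => a _; rewrite indic.
  apply: leq_trans (card_marks a); apply/subset_leq_card/subsetP => b.
  by rewrite inE => /andP[].
have bound3 : \sum_(a in X) \sum_(b in Y) (a \in marks b : nat) <= #|Y| * D.
  by rewrite exchange_big.
under eq_bigr => a _ do rewrite !big_split /=.
rewrite !big_split /=; have := bound2 X Y; move: X_large Y_large.
rewrite /Z; nia.
Qed.

Let K_ok : court_ok inv lab rel good K.
Proof.
apply/and4P; split.
- apply/forall_inP => r kr; apply/forall_inP => r' kr'; apply/implyP => neq.
  rewrite !kedgeE; apply/eqP/eta_sym; apply: contra neq => /eqP/kv_inj-> //.
- by apply/forall_inP => r _; rewrite ktypeE; case: V_valid => _ _ + _; apply.
- apply/forall_inP => q; rewrite inE => big_q.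
  have /card_gt0P[a] : 0 < #|[set a | col a == q]| by apply: leq_trans big_q.
  by rewrite inE => /eqP<-; case: V_valid => _ _ + _; apply.
- apply/forall_inP => q; rewrite inE => big_q; apply/forall_inP => q'; rewrite inE.
  exact: big_silent.
Qed.

Let star_of_ok a : ~~ isking a -> star_ok inv thr lab rel loop K (star_of a).
Proof.
move=> nka; apply/and4P; split; first by rewrite inE; move: nka; rewrite negbK.
- apply/forallP => d; rewrite slot_ofE; case ad: (fslot a d) => [m|] //.
  have [b [/setDP[ab nkb] _ _ ->]] := fslotP ad; rewrite /slot_ok /=.
  apply/andP; split; first by move: nkb; rewrite !inE negbK.
  case: ifP => ba; first by apply: mut_col; rewrite /mut ab.
  have neq_ab : a != b by apply: contraTneq ab => ->; apply: marks_irr.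
  by rewrite -eta_sym // unmarked_quiet ?ba // eq_sym.
- apply/forallP => d; apply/forallP => d'; apply/implyP => neq_d.
  rewrite !slot_ofE; case ad: (fslot a d) => [m|] //; case ad': (fslot a d') => [m'|]; last first.
    by rewrite /slot_conflict; case: m {ad} => [[? ?] [|]].
  have [b [/setDP[ab _] b_d lt_d ->]] := fslotP ad.
  have [b' [/setDP[ab' _] b_d' lt_d' ->]] := fslotP ad'.
  rewrite /slot_conflict; case: ifP => // ba; case: ifP => // b'a.
  apply: contra neq_d => /eqP/(mut_inj (a := a)); rewrite /mut ab ab' ba b'a => /(_ isT isT).
  by rewrite b_d b_d' => /eqP; rewrite nth_uniq ?enum_uniq // => /eqP/val_inj->.
(* The star counts all edges to kings, marked or not, and the marked edges to the others. This
   number lies between the marked edges and all edges, as [lab_between] requires. *)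
apply/forallP => j; apply/eqP; rewrite -addnA.
have -> : king_count rel K (star_of a) j = #|[set b | isking b && (b \in nbrs a j)]|.
  apply: card_kings => r /kv_isking kr; rewrite inE ktypeE /sedge ffunE.
  by rewrite (contraNneq _ nka) // => <-.
rewrite card_slot_rel; apply: lab_between.
  rewrite (cardsE_split isking); apply: leq_add; apply/subset_leq_card/subsetP => b.
    by rewrite !inE => /and3P[-> _].
  by rewrite !inE => /and3P[-> ->].
rewrite -[leqRHS](_ : #|[set b | b \in nbrs a j]| = _); last by apply: eq_card => b; rewrite inE.
rewrite [leqRHS](cardsE_split isking); apply: leq_add => //.
by apply/subset_leq_card/subsetP => b; rewrite !inE => /andP[/andP[-> _] ->].
Qed.

Let msum q q' e := \sum_(s | (scol s == q) && mutual s e q') w s.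

(** Sending a vertex of colour [q] to a mutual partner is injective, because two vertices of equal
    colour never share a mutual partner. Applied to [inv e] as well, this yields equality. *)
Let msum_leq q q' e : msum q q' e <= msum q' q (inv e).
Proof.
pose P a b := [&& b \in folk a, a \in marks b, eta a b == e & col b == q'].
pose f a := odflt a [pick b | P a b].
have fP a : mutual (star_of a) e q' -> P a (f a).
  rewrite mutual_star_of /f; case: pickP => // no /existsP[b].
  by move: (no b); rewrite /P => ->.
pose A := [set a | ~~ isking a && ((scol (star_of a) == q) && mutual (star_of a) e q')].
have f_inj : {in A &, injective f}.
  move=> a a'; rewrite !inE => /and3P[_ /eqP qa /fP/and4P[/setDP[fa _] af _ _]].
  move=> /and3P[_ /eqP qa' /fP/and4P[/setDP[fa' _] af' _ _]] eq_f.
  apply: (mut_inj (a := f a)); first by rewrite /mut af fa.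
    by rewrite /mut eq_f af' fa'.
  exact: etrans qa (esym qa').
pose P1 (s : star T E C R D) := (scol s == q) && mutual s e q'.
pose P2 (s : star T E C R D) := (scol s == q') && mutual s (inv e) q.
apply: leq_trans (eq_leq (sum_w P1)) _; apply: leq_trans (eq_leq (esym (sum_w P2))).
apply: (@leq_trans #|f @: A|); first exact: eq_leq (esym (card_in_imset f_inj)).
apply/subset_leq_card/subsetP => _ /imsetP[a + ->].
rewrite /A inE => /and3P[nka /eqP qa /fP/and4P[/setDP[fa nkf] af /eqP eta_a /eqP qf]].
rewrite inE; move: nkf; rewrite inE => ->.
rewrite /P2 -[scol (star_of (f a))]/(col (f a)) qf eqxx mutual_star_of /=.
apply/existsP; exists a; rewrite !inE af nka fa /= -qa eqxx andbT.
rewrite eta_sym ?eta_a //; apply: contraTneq fa => <-; exact: marks_irr.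
Qed.

Hypothesis invK : involutive inv.

Let w_solution : solution inv thr lab rel loop K w.
Proof.
split.
- move=> s; apply: contraNeq; rewrite -lt0n => /card_gt0P[a].
  by rewrite inE => /andP[nka /eqP<-]; apply: star_of_ok.
- move=> q; rewrite inE => big_q; rewrite sum_w; apply: leq_trans (big_q) _.
  apply/subset_leq_card/subsetP => a; rewrite !inE => /eqP qa.
  by rewrite -[scol (star_of a)]/(col a) /isking qa eqxx andbT negbK.
- move=> q q' e; apply/eqP; rewrite -[_ == _]/(msum q q' e == msum q' q (inv e)).
  rewrite eqn_leq; apply/andP; split; first exact: msum_leq.
  by have := msum_leq q' q (inv e); rewrite (invK e).
- move=> r kr j; rewrite ktypeE labE; congr (_ <= _); rewrite /king_const ktypeE -addnA.
  congr (_ + _).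
  have -> : #|nbrs (kv r) j| = #|[set b | b \in nbrs (kv r) j]|.
    by apply: eq_card => b; rewrite inE.
  rewrite (cardsE_split isking); congr (_ + _).
    symmetry; apply: card_kings => r' kr'; rewrite inE kedgeE ktypeE.
    by congr (~~ _ && _); apply/eqP/eqP => [->//|/kv_inj->].
  rewrite sum_w; apply: eq_card => a; rewrite !inE; case: (boolP (isking a)) => //= nka.
  have neq : a != kv r by apply: contraNneq nka => ->; apply: kv_isking.
  by rewrite neq /king_rel ktypeE /sedge ffunE /= -eta_sym.
rewrite (sum_w predT) -[#|kings K|](_ : #|[set r in kset | true]| = _); last first.
  by apply: eq_card => r; rewrite inE andbT.
rewrite (card_kings (P' := predT)) // -(cardsE_split isking predT).
by rewrite (_ : [set a | _] = setT) ?cardsT //; apply/setP => a; rewrite !inE.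
Qed.

Let w_count (P : pred T) : #|[set a | P (tau a)]| =
  #|[set r in kings K | P (ktype K r)]| + \sum_(s | P (scol s).1) w s.
Proof.
rewrite (cardsE_split isking) sum_w; congr (_ + _).
by symmetry; apply: card_kings => r _; rewrite ktypeE.
Qed.

Lemma enumerated_solution : exists (K : court T E C R) (w : star T E C R D -> nat),
  [/\ court_ok inv lab rel good K, solution inv thr lab rel loop K w
    & forall P : pred T, #|[set a | P (tau a)]| =
        #|[set b in kings K | P (ktype K b)]| + \sum_(s | P (scol s).1) w s].
Proof. by exists K, w. Qed.

End Enumerated.

Lemma coloured_solution : involutive inv ->
  exists (K : court T E C R) (w : star T E C R D -> nat),
  [/\ court_ok inv lab rel good K, solution inv thr lab rel loop K w
    & forall P : pred T, #|[set a | P (tau a)]| =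
        #|[set b in kings K | P (ktype K b)]| + \sum_(s | P (scol s).1) w s].
Proof.
by move=> invK; have [kv [kv_inj kv_im]] := ex_king_enum; apply: (enumerated_solution kv_inj).
Qed.

End Coloured.

Lemma valid_solution : involutive inv ->
  exists (K : court T E C R) (w : star T E C R D -> nat),
  [/\ court_ok inv lab rel good K, solution inv thr lab rel loop K w
    & forall P : pred T, #|[set a | P (tau a)]| =
        #|[set b in kings K | P (ktype K b)]| + \sum_(s | P (scol s).1) w s].
Proof. by have [chi chiP] := ex_colouring; apply: coloured_solution chiP. Qed.

End StarsOfStructure.

(** * Existential Presburger formulas *)

Lemma vcons_ext k a (u v : 'I_k -> nat) : u =1 v -> vcons a u =1 vcons a v.
Proof. by move=> uv i; rewrite /vcons; case: unlift. Qed.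

Lemma teval_ext k (t : pterm k) (u v : 'I_k -> nat) : u =1 v -> teval u t = teval v t.
Proof. by move=> uv; elim: t => //= s -> t ->. Qed.

Lemma holds_ext k (f : pform k) (u v : 'I_k -> nat) : u =1 v -> holds f u <-> holds f v.
Proof.
elim: f u v => {k} /= [k s t|k s t|k f IH|k f IHf g IHg|k f IHf g IHg|k f IH|k f IH] u v uv.
- by rewrite !(teval_ext _ uv).
- by rewrite !(teval_ext _ uv).
- by rewrite (IH _ _ uv).
- by rewrite (IHf _ _ uv) (IHg _ _ uv).
- by rewrite (IHf _ _ uv) (IHg _ _ uv).
- by split=> -[a fa]; exists a; move: fa; rewrite (IH _ _ (vcons_ext a uv)).
- by split=> fa a; move: (fa a); rewrite (IH _ _ (vcons_ext a uv)).
Qed.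

Fixpoint exists_prefix (N k : nat) : pform (N + k) -> pform k :=
  match N with
  | 0 => fun f => f
  | N'.+1 => fun f => exists_prefix (N := N') (PEx f)
  end.

Lemma holds_exists_prefix N k (f : pform (N + k)) v :
  holds (exists_prefix f) v <->
  exists u : 'I_(N + k) -> nat, (forall i, u (rshift N i) = v i) /\ holds f u.
Proof.
elim: N f => [|N IH] f /=.
  split=> [fv|[u [uv fu]]].
    by exists v; split=> // i; congr v; apply: val_inj.
  apply: (proj1 (holds_ext f _)) fu => i; rewrite -uv; congr u; exact: val_inj.
have lift_rshift i : rshift N.+1 i = lift ord0 (rshift N i) :> 'I_(N + k).+1.
  exact: val_inj.
rewrite IH; split=> [[u [uv [a fa]]]|[u [uv fu]]].
  exists (vcons a u); split=> // i.
  by rewrite -uv /vcons lift_rshift liftK.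
exists (fun i => u (lift ord0 i)); split=> [i|].
  by rewrite -uv lift_rshift.
exists (u ord0); apply: (proj1 (holds_ext f _)) fu => i.
by rewrite /vcons; case: unliftP => [j|] ->.
Qed.

Lemma existential_quantifier_free k (f : pform k) : quantifier_free f -> existential f.
Proof. by case: f. Qed.

Lemma existential_exists_prefix N k (f : pform (N + k)) :
  existential f -> existential (exists_prefix f).
Proof. by elim: N f => //= N IH f fex; apply: IH. Qed.

Lemma psize_exists_prefix N k (f : pform (N + k)) :
  psize (exists_prefix f) = psize f + 2 * N.
Proof. by elim: N f => [|N IH] f; rewrite ?muln0 ?addn0 //= IH mulnS addnA addn2. Qed.

Section Finitary.

Variables (k : nat) (I : finType).

Definition forall_in (P : pred I) (F : I -> pform k) : pform k :=
  foldr (fun i f => PAnd (F i) f) (PEq (TZero k) (TZero k)) (enum P).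

Definition exists_in (P : pred I) (F : I -> pform k) : pform k :=
  foldr (fun i f => POr (F i) f) (PLt (TZero k) (TZero k)) (enum P).

Lemma holds_forall_in P F v :
  holds (forall_in P F) v <-> forall i, P i -> holds (F i) v.
Proof.
rewrite /forall_in.
suff -> : holds (foldr (fun i f => PAnd (F i) f) (PEq (TZero k) (TZero k)) (enum P)) v
    <-> forall i, i \in enum P -> holds (F i) v.
  by split=> H i Pi; apply: H; move: Pi; rewrite mem_enum.
elim: (enum P) => [|i s IH] /=; first by split.
rewrite IH; split=> [[Fi Fs] j|H]; first by rewrite inE => /predU1P[->|/Fs].
by split=> [|j sj]; apply: H; rewrite inE ?eqxx // sj orbT.
Qed.

Lemma holds_exists_in P F v :
  holds (exists_in P F) v <-> exists2 i, P i & holds (F i) v.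
Proof.
rewrite /exists_in.
suff -> : holds (foldr (fun i f => POr (F i) f) (PLt (TZero k) (TZero k)) (enum P)) v
    <-> exists2 i, i \in enum P & holds (F i) v.
  by split=> -[i Pi Fi]; exists i => //; move: Pi; rewrite mem_enum.
elim: (enum P) => [|i s IH] /=; first by split=> // -[].
rewrite IH; split=> [[Fi|[j sj Fj]]|[j]].
- by exists i; rewrite ?mem_head.
- by exists j; rewrite // inE sj orbT.
- by rewrite inE => /predU1P[->|sj Fj]; [left|right; exists j].
Qed.

Lemma quantifier_free_forall_in P F :
  (forall i, quantifier_free (F i)) -> quantifier_free (forall_in P F).
Proof. by move=> qf; rewrite /forall_in; elim: (enum P) => //= i s ->; rewrite qf. Qed.

Lemma quantifier_free_exists_in P F :
  (forall i, quantifier_free (F i)) -> quantifier_free (exists_in P F).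
Proof. by move=> qf; rewrite /exists_in; elim: (enum P) => //= i s ->; rewrite qf. Qed.

Lemma psize_forall_in (P : pred I) (F : I -> pform k) n :
  (forall i, psize (F i) <= n) -> psize (forall_in P F) <= 3 + #|I| * n.+1.
Proof.
move=> Fn; apply: (@leq_trans (3 + #|P| * n.+1)); last first.
  by rewrite leq_add2l leq_mul2r max_card orbT.
rewrite /forall_in cardE; elim: (enum P) => //= i s IH.
by move: (Fn i); lia.
Qed.

Lemma psize_exists_in (P : pred I) (F : I -> pform k) n :
  (forall i, psize (F i) <= n) -> psize (exists_in P F) <= 3 + #|I| * n.+1.
Proof.
move=> Fn; apply: (@leq_trans (3 + #|P| * n.+1)); last first.
  by rewrite leq_add2l leq_mul2r max_card orbT.
rewrite /exists_in cardE; elim: (enum P) => //= i s IH.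
by move: (Fn i); lia.
Qed.

End Finitary.

Section LinearTerms.

Variables (W : finType) (k : nat).

(** The first [#|W|] variables hold the multiplicities of the stars and will be quantified; the last
    [k] stay free. *)
Definition wvar (x : W) : 'I_(#|W| + k) := lshift k (enum_rank x).

Definition lin (c : nat) (P : pred W) : pterm (#|W| + k) :=
  foldr (fun x t => TAdd (TVar (wvar x)) t)
    (iter c (TAdd (TOne _)) (TZero _)) (enum P).

Lemma teval_lin u c P : teval u (lin c P) = c + \sum_(x | P x) u (wvar x).
Proof.
rewrite /lin -big_enum /=; elim: (enum P) => [|x s IH] /=.
  by rewrite big_nil addn0; elim: c => //= c ->.
by rewrite IH big_cons addnCA.
Qed.

Lemma teval_lin0 u P : teval u (lin 0 P) = \sum_(x | P x) u (wvar x).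
Proof. exact: teval_lin. Qed.

Lemma tsize_lin c P : Defs.tsize (lin c P) <= (2 * (c + #|W|)).+1.
Proof.
apply: (@leq_trans (2 * (c + #|P|)).+1); last by rewrite ltnS leq_mul2l leq_add2l max_card.
rewrite /lin cardE; elim: (enum P) => [|x s] /=; last by move: (Defs.tsize _) => t; lia.
by elim: c => //= c; move: (Defs.tsize _) => t; lia.
Qed.

End LinearTerms.

Lemma card_sets (A : finType) : #|{set A}| = 2 ^ #|A|.
Proof. by rewrite -(cardsT A) -card_powerset powersetT cardsT. Qed.

(** * The spectrum of a pairing problem as a formula, and its size *)

Section Counting.

Variables (T E : finType) (inv : E -> E) (l : nat) (thr : 'I_l -> nat).
Variables (lab : 'I_l -> T -> bool) (rel : 'I_l -> T -> E -> T -> bool).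
Variables (loop : 'I_l -> T -> bool) (good : pred T).
Variables (k : nat) (f : T -> 'I_k).
Hypothesis invK : involutive inv.

Definition realizable (v : 'I_k -> nat) : Prop :=
  exists (V : finType) (tau : V -> T) (eta : V -> V -> E),
    valid inv thr lab rel loop good tau eta /\
    forall i, #|[set a | f (tau a) == i]| = v i.

Section Formula.

Variables (C R D : nat).

Notation W := (star T E C R D).
Notation lin := (@lin W k).

(** With strict comparison as the atom, a true label reads [thr j < ... + 1] and a false one the
    reverse strict inequality. *)
Definition king_form (K : court T E C R) (b : 'I_R) (j : 'I_l) :=
  let sent := king_rel inv rel K b j in
  if lab j (ktype K b)
  then PLt (lin (thr j) pred0) (lin (king_const rel loop K b j).+1 sent)
  else PLt (lin (king_const rel loop K b j) sent) (lin (thr j) pred0).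

(** A single equation with zero excludes all incorrect stars at once, and [(6 * D).+2 <] expresses
    [3 * (2 * D).+1 <=]. The last conjunct ties the free variables to the numbers of vertices. *)
Definition solution_form (K : court T E C R) : pform (#|W| + k) :=
  PAnd (PEq (lin 0 (predC (star_ok inv thr lab rel loop K))) (TZero _))
  (PAnd (forall_in (mem (large K)) (fun q =>
      PLt (lin (6 * D).+2 pred0) (lin 0 (fun s => scol s == q))))
  (PAnd (forall_in predT (fun qe : colour T C * colour T C * E =>
      let: (q, q', e) := qe in
      PEq (lin 0 (fun s => (scol s == q) && mutual s e q'))
          (lin 0 (fun s => (scol s == q') && mutual s (inv e) q))))
  (PAnd (forall_in (fun bj => bj.1 \in kings K) (fun bj => king_form K bj.1 bj.2))
  (PAnd (PLt (TZero _) (lin #|kings K| predT))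
  (forall_in predT (fun i : 'I_k =>
      PEq (TVar (rshift #|W| i))
          (lin #|[set b in kings K | f (ktype K b) == i]|
             (fun s => f (scol s).1 == i)))))))).

Lemma holds_solution_form K u : holds (solution_form K) u <->
  solution inv thr lab rel loop K (fun s => u (wvar k s)) /\
  forall i, u (rshift #|W| i) = #|[set b in kings K | f (ktype K b) == i]| +
    \sum_(s | f (scol s).1 == i) u (wvar k s).
Proof.
rewrite /solution_form [holds _ _]/= !holds_forall_in.
have kingE b j : holds (king_form K b j) u <-> lab j (ktype K b) =
    (thr j <= king_const rel loop K b j + \sum_(s | king_rel inv rel K b j s) u (wvar k s)).
  rewrite /king_form; case: (lab j _); rewrite /= !teval_lin big_pred0_eq addn0 ?ltnS.
    by split=> [->|<-].
  by rewrite ltnNge; split=> [/negPf->|<-].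
rewrite teval_lin add0n; split.
  move=> [ok [lg [mt [kg [ne ct]]]]]; split; last first.
    by move=> i; have /= := ct i isT; rewrite teval_lin.
  split.
  - by move=> s; move/eqP: ok; rewrite sum_nat_eq0 => /forallP/(_ s)/implyP sP /sP/eqP.
  - move=> q Lq; have /= := lg q Lq; rewrite !teval_lin big_pred0_eq addn0 add0n.
    by apply: leq_trans; lia.
  - by move=> q q' e;
    apply: etrans (esym (teval_lin0 u _)) (etrans (mt (q, q', e) isT) (teval_lin0 u _)).
  - move=> b Kb j; apply/kingE; exact: (kg (b, j) Kb).
  - by move: ne => /=; rewrite teval_lin.
move=> [[ok lg mt kg ne] ct].
split; [|split; [|split; [|split; [|split]]]].
- by apply: big1 => s; apply: ok.
- move=> q Lq /=; rewrite !teval_lin big_pred0_eq addn0 add0n.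
  by apply: leq_trans (lg q Lq); lia.
- by move=> [[q q'] e] _;
  apply: etrans (teval_lin0 u _) (etrans (mt q q' e) (esym (teval_lin0 u _))).
- by move=> [b j] Kb; apply/kingE; apply: kg.
- by rewrite /= teval_lin.
- by move=> i _ /=; rewrite teval_lin.
Qed.

Lemma quantifier_free_solution_form K : quantifier_free (solution_form K).
Proof.
rewrite /= !quantifier_free_forall_in //; last by move=> [[]].
by move=> b; rewrite /king_form; case: ifP.
Qed.

(** Every atom has size at most [8 * X + 3], and each of the four finite conjunctions has at most
    [X] members. *)
Lemma psize_solution_form K X :
  (6 * D).+2 <= X -> R.+2 <= X -> (forall j, thr j <= X) -> #|W| <= X ->
  #|T| * C * (#|T| * C) * #|E| <= X -> R * l <= X -> k <= X ->
  #|colour T C| <= X -> psize (solution_form K) <= 120 * X ^ 2 + 100.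
Proof.
move=> DX RX thrX WX QX RlX kX cX.
have linX c P : c <= X -> Defs.tsize (lin c P) <= (4 * X).+1.
  by move=> cX'; apply: leq_trans (tsize_lin _ _ _) _; lia.
have setX (P : pred 'I_R) : #|[set b | P b]| <= R by rewrite -[leqRHS]card_ord max_card.
have constX b j : (king_const rel loop K b j).+1 <= X.
  apply: leq_trans RX; rewrite /king_const ltnS -[R.+1]add1n leq_add ?setX //.
  by case: loop.
have X0 : 0 <= X by [].
have atomX c c' P P' : c <= X -> c' <= X ->
    (Defs.tsize (lin c P) + Defs.tsize (lin c' P')).+1 <= 8 * X + 3.
  by move=> cX1 cX2; have := linX c P cX1; have := linX c' P' cX2; lia.
have s1 : psize (PEq (lin 0 (predC (star_ok inv thr lab rel loop K))) (TZero _)) <= 8 * X + 3.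
  by apply: (@leq_trans (4 * X).+3); [rewrite /= addn1 !ltnS linX | lia].
have s2 := @psize_forall_in _ _ (mem (large K)) (fun q =>
  PLt (lin (6 * D).+2 pred0) (lin 0 (fun s => scol s == q))) _ (fun q => atomX _ _ _ _ DX X0).
have s3 : forall qe : colour T C * colour T C * E, psize (let: (q, q', e) := qe in
      PEq (lin 0 (fun s => (scol s == q) && mutual s e q'))
          (lin 0 (fun s => (scol s == q') && mutual s (inv e) q))) <= 8 * X + 3.
  by move=> [[q q'] e]; apply: atomX.
have {}s3 := psize_forall_in predT s3.
have s4 : forall bj : 'I_R * 'I_l, psize (king_form K bj.1 bj.2) <= 8 * X + 3.
  by move=> [b j]; rewrite /king_form; case: ifP => _; apply: atomX => //=; apply: ltnW.
have {}s4 := psize_forall_in (fun bj => bj.1 \in kings K) s4.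
have s5 : psize (PLt (TZero _) (lin #|kings K| predT)) <= 8 * X + 3.
  apply: (@leq_trans (4 * X).+3); [rewrite /= add1n !ltnS linX // | lia].
  by apply: leq_trans (max_card _) _; rewrite card_ord; lia.
have s6 : forall i : 'I_k, psize (PEq (TVar (rshift #|W| i))
    (lin #|[set b in kings K | f (ktype K b) == i]| (fun s => f (scol s).1 == i))) <= 8 * X + 3.
  move=> i; apply: (@leq_trans (4 * X).+3); [rewrite /= add1n !ltnS linX // | lia].
  by apply: leq_trans (setX _) _; lia.
have {}s6 := psize_forall_in predT s6.
have QX' : #|{: colour T C * colour T C * E}| <= X by rewrite !card_prod card_ord.
have RlX' : #|{: 'I_R * 'I_l}| <= X by rewrite card_prod !card_ord.
have kX' : #|'I_k| <= X by rewrite card_ord.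
have mulX n : n <= X -> 3 + n * (8 * X + 3).+1 <= 8 * X ^ 2 + 4 * X + 3.
  by move=> nX; have := leq_mul nX (leqnn (8 * X + 4)); rewrite expnS expn1; nia.
have {}s2 := leq_trans s2 (mulX _ cX).
have {}s3 := leq_trans s3 (mulX _ QX').
have {}s4 := leq_trans s4 (mulX _ RlX').
have {}s6 := leq_trans s6 (mulX _ kX').
have XX : X <= X ^ 2 by rewrite expnS expn1; nia.
have andX (g h : pform (#|W| + k)) a b :
    psize g <= a -> psize h <= b -> psize (PAnd g h) <= (a + b).+1.
  by move=> ga hb; rewrite /= ltnS leq_add.
apply: leq_trans (andX _ _ _ _ s1 (andX _ _ _ _ s2 (andX _ _ _ _ s3
  (andX _ _ _ _ s4 (andX _ _ _ _ s5 s6))))) _.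
lia.
Qed.

End Formula.

Let D := \sum_j thr j.
Let C := (D + D * D).+1.
Let R := #|colour T C| * (3 * (2 * D).+1).

(** All courts share the same star variables, so the disjunction over them stays quantifier-free
    below one prefix, as [existential] demands. *)
Definition spectrum_form : pform k :=
  exists_prefix (exists_in (@court_ok T E inv l lab rel good C R) (@solution_form C R D)).

Lemma spectrum_form_existential : existential spectrum_form.
Proof.
apply/existential_exists_prefix/existential_quantifier_free.
by apply: quantifier_free_exists_in => K; apply: quantifier_free_solution_form.
Qed.

Lemma spectrum_form_defines : defines spectrum_form realizable.
Proof.
move=> v; rewrite /spectrum_form holds_exists_prefix; split.
  move=> [u [uv /holds_exists_in[K Kok /holds_solution_form[sol count]]]].
  have [V [tau [eta [Vok countV]]]] := solution_realized invK Kok sol.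
  exists V, tau, eta; split=> // i; rewrite -uv count.
  exact: (countV (fun t => f t == i)).
move=> [V [tau [eta [Vok countV]]]].
have [K [w [Kok sol count]]] := valid_solution Vok invK.
exists (fun i => match split i with inl x => w (enum_val x) | inr i => v i end).
split=> [i|]; first by rewrite -[rshift _ i]/(unsplit (inr i)) unsplitK.
apply/holds_exists_in; exists K => //; apply/holds_solution_form.
have wE s : match split (wvar k s) with inl x => w (enum_val x) | inr i => v i end = w s.
  by rewrite -[wvar k s]/(unsplit (inl (enum_rank s))) unsplitK enum_rankK.
have sumE P : \sum_(s | P s) match split (wvar k s) with
    inl x => w (enum_val x) | inr i => v i end = \sum_(s | P s) w s.
  by apply: eq_bigr => s _; rewrite wE.
split; last first.
  move=> i; rewrite sumE -[rshift _ i]/(unsplit (inr i)) unsplitK -countV.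
  exact: (count (fun t => f t == i)).
case: sol => ok lg mt kg ne; split.
- by move=> s /ok; rewrite wE.
- by move=> q /lg; rewrite sumE.
- by move=> q q' e; apply: etrans (sumE _) (etrans (mt q q' e) (esym (sumE _))).
- by move=> b Kb j; rewrite sumE kg.
- by rewrite sumE.
Qed.

Lemma card_star C' R' D' : #|star T E C' R' D'| =
  #|T| * C' * #|E| ^ R' * (#|E| * (#|T| * C') * 2).+1 ^ D'.
Proof. by rewrite !(card_prod, card_ffun, card_option, card_ord, card_bool). Qed.

Lemma card_court C' R' : #|court T E C' R'| =
  2 ^ R' * #|T| ^ R' * #|E| ^ (R' * R') * 2 ^ (#|T| * C').
Proof. by rewrite !(card_prod, card_ffun, card_sets, card_ord). Qed.

(** The numbers of colours and of kings are polynomial in [B]. Stars and courts are functions on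
    these, so there are at most [X = 2 ^ (B ^ 19)] of each. A disjunction of [X] formulas of size
    quadratic in [X], with its prefix, stays below [X ^ 4]. *)
Lemma psize_spectrum_form B : 1 < B -> #|T| <= B -> #|E| <= B -> l <= B ->
  D <= B -> k <= B -> psize spectrum_form <= 2 ^ (B ^ 22).
Proof.
move=> B1 TB EB lB DB kB.
have B0 : 0 < B by apply: ltnW.
have pow a b : a <= b -> B ^ a <= B ^ b by move=> ab; rewrite leq_pexp2l.
have pow2 a b : a <= b -> 2 ^ (B ^ a) <= 2 ^ (B ^ b).
  by move=> ab; rewrite leq_pexp2l // pow.
have lift x a : x <= B ^ a -> x <= 2 ^ (B ^ a).
  by move=> xa; apply: leq_trans (ltnW (ltn_expl x (ltnSn 1))) _; rewrite leq_pexp2l.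
have powX x y a b : x <= 2 ^ (B ^ a) -> y <= B ^ b -> x ^ y <= 2 ^ (B ^ (a + b)).
  move=> xa yb; apply: (@leq_trans ((2 ^ (B ^ a)) ^ y)).
    by case: y {yb} => // y; rewrite leq_exp2r.
  by rewrite -expnM leq_pexp2l // expnD leq_mul2l yb orbT.
have liftB x : x <= B -> x <= 2 ^ (B ^ 1) by move=> xB; apply: lift; rewrite expn1.
have four a : 4 * B ^ a <= B ^ (a + 2).
  by rewrite expnD mulnC leq_mul2l -[4]/(2 ^ 2) leq_exp2r ?B1 ?orbT.
have CB : C <= B ^ 3.
  by rewrite /C !expnS expn0 muln1; nia.
have cB : #|T| * C <= B ^ 4 by rewrite expnS leq_mul.
have B3 : 8 <= B ^ 3 by rewrite -[8]/(2 ^ 3) leq_exp2r.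
have ZB : 3 * (2 * D).+1 <= B ^ 4 by rewrite expnS; nia.
have RB : R <= B ^ 8.
  by rewrite /R card_prod card_ord -[8]/(4 + 4) expnD leq_mul.
have msgB : (#|E| * (#|T| * C) * 2).+1 <= B ^ 7.
  apply: (@leq_trans (4 * B ^ 5)); last exact: four.
  have : #|E| * (#|T| * C) <= B ^ 5 by rewrite expnS leq_mul.
  have : 0 < B ^ 5 by rewrite expn_gt0 B0.
  by lia.
have starX : #|star T E C R D| <= 2 ^ (B ^ 19).
  rewrite card_star; apply: leq_trans (leq_mul (leq_mul (lift _ _ cB)
    (powX _ _ _ _ (liftB _ EB) RB))
    (powX _ _ _ 1 (lift _ _ msgB) _)) _; first by rewrite expn1.
  rewrite -!expnD leq_pexp2l //; apply: leq_trans (four 17).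
  by have := pow 4 17 isT; have := pow 9 17 isT; have := pow 8 17 isT; lia.
have courtX : #|court T E C R| <= 2 ^ (B ^ 19).
  have RR : R * R <= B ^ 16 by rewrite -[16]/(8 + 8) expnD leq_mul.
  rewrite card_court; apply: leq_trans (leq_mul (leq_mul (leq_mul (leq_pexp2l _ RB)
    (powX _ _ _ _ (liftB _ TB) RB)) (powX _ _ _ _ (liftB _ EB) RR)) (leq_pexp2l _ cB)) _ => //.
  rewrite -!expnD leq_pexp2l //; apply: leq_trans (four 17).
  by have := pow 4 17 isT; have := pow 9 17 isT; have := pow 8 17 isT; lia.
have smallX x a : a <= 19 -> x <= B ^ a -> x <= 2 ^ (B ^ 19).
  by move=> a19 xa; apply: leq_trans (lift _ _ xa) (pow2 _ _ a19).
set X := 2 ^ (B ^ 19) in starX courtX smallX.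
have bodyX (K : court T E C R) : psize (solution_form D K) <= 120 * X ^ 2 + 100.
  apply: psize_solution_form => //.
  - by apply: (smallX _ 4) => //; apply: leq_trans ZB; lia.
  - apply: (smallX _ 10) => //; apply: leq_trans (four 8).
    apply: (@leq_trans (B ^ 8).+2); first by rewrite !ltnS; apply: RB.
    by have := pow 0 8 isT; rewrite expn0; move: (B ^ 8) => b; lia.
  - move=> j; apply: (smallX _ 1) => //; rewrite expn1; apply: leq_trans DB.
    by rewrite /D (bigD1 j) //= leq_addr.
  - by apply: (smallX _ 9) => //; rewrite -[9]/(4 + 4 + 1) !expnD expn1 !leq_mul.
  - by apply: (smallX _ 9) => //; rewrite -[9]/(8 + 1) expnD expn1 leq_mul.
  - by apply: (smallX _ 1); rewrite ?expn1.
  - by apply: (smallX _ 4) => //; rewrite card_prod card_ord.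
rewrite psize_exists_prefix.
apply: leq_trans (leq_add (psize_exists_in _ bodyX) (leq_mul (leqnn 2) starX)) _.
have X256 : 256 <= X.
  rewrite -[256]/(2 ^ 8) leq_pexp2l //; apply: leq_trans B3 _; exact: pow.
apply: (@leq_trans (X ^ 4)); last first.
  by rewrite -expnM leq_pexp2l // mulnC; apply: leq_trans (four 19) (pow _ _ _).
have := leq_mul courtX (leqnn (120 * X ^ 2 + 100).+1).
have : X <= X ^ 2 by rewrite expnS expn1 leq_pmulr // (leq_trans _ X256).
have X23 : X * X ^ 2 = X ^ 3 by rewrite -expnS.
have : 256 * X ^ 3 <= X ^ 4 by rewrite (expnS _ 3) leq_mul2r X256 orbT.
have : 256 * X ^ 2 <= X ^ 3 by rewrite (expnS _ 2) leq_mul2r X256 orbT.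
move: (X ^ 4) (X ^ 3) (X ^ 2) X23 X256 => X4 X3 X2 X23 X256.
move: (#|court _ _ _ _| * _) => P.
nia.
Qed.

End Counting.

(** * Two-variable formulas *)

Lemma c2_comparable n m : comparable (c2 n m).
Proof.
move=> phi psi; rewrite /decidable.
decide equality; solve [exact: eq_comparable | exact: Bool.bool_dec].
Qed.

HB.instance Definition _ n m := hasDecEq.Build (c2 n m) (compareP (@c2_comparable n m)).

Lemma sat_ext n m (G : structure n m) (phi : c2 n m) (e e' : var -> G) :
  e =1 e' -> sat e phi = sat e' phi.
Proof.
have updE v a (e1 e2 : var -> G) : e1 =1 e2 -> upd e1 v a =1 upd e2 v a.
  by move=> e12 w; rewrite /upd e12.
elim: phi e e' => /= [i v|i v w|v w|p IH|p IHp q IHq|p IHp q IHq|v p IH|v p IH|k v p IH] e e' ee'.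
- by rewrite ee'.
- by rewrite !ee'.
- by rewrite !ee'.
- by rewrite (IH _ _ ee').
- by rewrite (IHp _ _ ee') (IHq _ _ ee').
- by rewrite (IHp _ _ ee') (IHq _ _ ee').
- by apply: eq_existsb => a; apply/IH/updE.
- by apply: eq_forallb => a; apply/IH/updE.
- congr (_ <= _); apply: eq_card => a; rewrite !inE; exact/IH/updE.
Qed.

Section Quantifiers.

Variables (n m : nat).
Implicit Types (phi theta : c2 n m).

Fixpoint quantified phi : seq (c2 n m) :=
  match phi with
  | CUn _ _ | CBin _ _ _ | CEq _ _ => [::]
  | CNot p => quantified p
  | CAnd p q | COr p q => quantified p ++ quantified q
  | CEx _ p | CAll _ p | CAtLeast _ _ p => phi :: quantified p
  end.

Definition quantifier phi : bool :=
  match phi with CEx _ _ | CAll _ _ | CAtLeast _ _ _ => true | _ => false end.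

(** A uniform shape for all quantifiers: at least [qthr] values of [qvar] satisfy [qbody], negated
    when [qneg] holds. A universal formula becomes the negation of an existential one. *)
Definition qthr theta : nat := if theta is CAtLeast k _ _ then k else 1.
Definition qneg theta : bool := if theta is CAll _ _ then true else false.
Definition qvar theta : var :=
  match theta with CEx v _ | CAll v _ | CAtLeast _ v _ => v | _ => false end.
Definition qbody theta : c2 n m :=
  match theta with CEx _ p | CAtLeast _ _ p => p | CAll _ p => CNot p | _ => theta end.

Lemma quantified_quantifier phi theta : theta \in quantified phi -> quantifier theta.
Proof.
elim: phi => //= [p IHp q IHq|p IHp q IHq|v p IH|v p IH|k v p IH].
- by rewrite mem_cat => /orP[/IHp|/IHq].
- by rewrite mem_cat => /orP[/IHp|/IHq].
- by rewrite inE => /predU1P[->|/IH].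
- by rewrite inE => /predU1P[->|/IH].
- by rewrite inE => /predU1P[->|/IH].
Qed.

Lemma quantified_qbody phi theta :
  theta \in quantified phi -> {subset quantified (qbody theta) <= quantified phi}.
Proof.
elim: phi => //= [p IHp q IHq|p IHp q IHq|v p IH|v p IH|k v p IH].
- by rewrite mem_cat => /orP[/IHp|/IHq] sub x /sub; rewrite mem_cat => ->; rewrite ?orbT.
- by rewrite mem_cat => /orP[/IHp|/IHq] sub x /sub; rewrite mem_cat => ->; rewrite ?orbT.
- by rewrite inE => /predU1P[->|/IH sub] x; [|move/sub]; rewrite inE => ->; rewrite orbT.
- by rewrite inE => /predU1P[->|/IH sub] x; [|move/sub]; rewrite inE => ->; rewrite orbT.
- by rewrite inE => /predU1P[->|/IH sub] x; [|move/sub]; rewrite inE => ->; rewrite orbT.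
Qed.

Lemma size_quantified phi : size (quantified phi) <= c2_length phi.
Proof. by elim: phi => //= *; rewrite ?size_cat; lia. Qed.

(** Thresholds are binary numerals, so they may be exponential in the length; [D] is then
    exponential, and the numbers of stars and courts doubly so. *)
Lemma qthr_quantified phi theta :
  theta \in quantified phi -> qthr theta <= 2 ^ c2_length phi.
Proof.
have step a b c : a <= 2 ^ b -> b <= c -> a <= 2 ^ c.
  by move=> ab bc; apply: leq_trans ab _; rewrite leq_pexp2l.
elim: phi => //= [p IH|p IHp q IHq|p IHp q IHq|v p IH|v p IH|k v p IH].
- by move=> /IH/step; apply.
- by rewrite mem_cat => /orP[/IHp|/IHq] /step; apply; lia.
- by rewrite mem_cat => /orP[/IHp|/IHq] /step; apply; lia.
- by rewrite inE => /predU1P[->|/IH/step]; [rewrite expn_gt0|apply; lia].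
- by rewrite inE => /predU1P[->|/IH/step]; [rewrite expn_gt0|apply; lia].
- rewrite inE => /predU1P[->|/IH/step]; last by apply; lia.
  apply: (step _ (up_log 2 k.+1)); last lia.
  by apply: leq_trans (leqnSn k) (up_logP _ _).
Qed.

Lemma sat_quantifier (G : structure n m) (e : var -> G) theta :
  quantifier theta ->
  sat e theta = qneg theta (+)
    (qthr theta <= #|[set a | sat (upd e (qvar theta) a) (qbody theta)]|).
Proof.
case: theta => // [v p|v p] _ /=.
  apply/existsP/card_gt0P => -[a]; first by exists a; rewrite inE.
  by rewrite inE; exists a.
rewrite /addb -leqNgt leqn0 cards_eq0; apply/forallP/eqP => [all_p|none a].
  by apply/setP => a; rewrite !inE all_p.
by have := in_set0 a; rewrite -none inE => /negbFE.
Qed.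

(** The quantifier overwrites its own variable, so only the other value matters. This is what makes
    a quantified subformula a unary label. *)
Lemma sat_other_var (G : structure n m) (e : var -> G) theta : quantifier theta ->
  sat e theta = sat (fun=> e (~~ qvar theta)) theta.
Proof.
move=> qtheta; rewrite !sat_quantifier //; congr (_ (+) (_ <= _)).
apply: eq_card => a; rewrite !inE; apply: sat_ext => w.
by rewrite /upd; case: eqP => // /eqP; case: w (qvar theta) => [] [].
Qed.

End Quantifiers.

(** * Sentences as pairing problems *)

Section Encoding.

Variables (n m : nat) (phi : c2 n m).

Let closure : c2 n m := CAll false (CAll true phi).
Let qs : seq (c2 n m) := quantified closure.
Let l : nat := size qs.

(* Unary literals, loops, and the truth values of the quantified subformulas. *)
Definition utype : finType := ({ffun 'I_n -> bool} * {ffun 'I_m -> bool} * l.-tuple bool)%type.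
(** The binary atoms on an ordered pair of distinct elements, first in the given and then in the
    reverse direction. *)
Definition btype : finType := ({ffun 'I_m -> bool} * {ffun 'I_m -> bool})%type.

Definition binv (e : btype) : btype := (e.2, e.1).

Lemma binvK : involutive binv. Proof. by case. Qed.

Definition label (t : utype) (theta : c2 n m) : bool := nth false t.2 (index theta qs).

(** Evaluation of the outermost layer only: a quantified subformula is not entered but read off the
    label at the other variable. *)
Fixpoint ev (ty : var -> utype) (r : 'I_m -> var -> var -> bool)
    (eqv : var -> var -> bool) (psi : c2 n m) : bool :=
  match psi with
  | CUn i v => (ty v).1.1 i
  | CBin i v w => r i v w
  | CEq v w => eqv v w
  | CNot p => ~~ ev ty r eqv p
  | CAnd p q => ev ty r eqv p && ev ty r eqv q
  | COr p q => ev ty r eqv p || ev ty r eqv q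
  | CEx v _ | CAll v _ | CAtLeast _ v _ => label (ty (~~ v)) psi
  end.

Lemma ev_ext ty ty' r r' eqv eqv' psi :
  ty =1 ty' -> (forall i v w, r i v w = r' i v w) -> (forall v w, eqv v w = eqv' v w) ->
  ev ty r eqv psi = ev ty' r' eqv' psi.
Proof.
move=> tyE rE eqE.
by elim: psi => //= [i v|p ->|p -> q ->|p -> q ->|v p _|v p _|k v p _]; rewrite ?tyE.
Qed.

Let theta (j : 'I_l) : c2 n m := nth closure qs j.

Let thr (j : 'I_l) : nat := qthr (theta j).
(** Adding [qneg] modulo 2 turns the truth value of the formula into that of the positive threshold
    statement required by [valid]. *)
Let lab (j : 'I_l) (t : utype) : bool := qneg (theta j) (+) label t (theta j).
(** The quantified variable sits at the far end [t'] and the other one at [t]; atoms between the two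
    are read off the edge type in the matching direction. *)
Let rel (j : 'I_l) (t : utype) (e : btype) (t' : utype) : bool :=
  let v := qvar (theta j) in
  ev (fun w => if w == v then t' else t)
     (fun i w w' => if w == v then (if w' == v then t'.1.2 i else e.2 i)
                    else (if w' == v then e.1 i else t.1.2 i))
     (fun w w' => w == w') (qbody (theta j)).
Let loop (j : 'I_l) (t : utype) : bool :=
  ev (fun=> t) (fun i _ _ => t.1.2 i) (fun _ _ => true) (qbody (theta j)).
Let good (t : utype) : bool := label t closure.

Let theta_qs j : theta j \in qs. Proof. exact: mem_nth. Qed.
Let theta_quantifier j : quantifier (theta j).
Proof. exact: quantified_quantifier (theta_qs j). Qed.

Section Interpretation.

Variables (G : structure n m) (tau : G -> utype) (eta : G -> G -> btype).
Hypothesis tau_un : forall i a, (tau a).1.1 i = un i a.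
Hypothesis tau_bin : forall i a, (tau a).1.2 i = bin i a a.
Hypothesis eta_bin : forall i a b, a != b -> (eta a b).1 i = bin i a b.
Hypothesis eta_bin_rev : forall i a b, a != b -> (eta a b).2 i = bin i b a.

Let evG (e : var -> G) (psi : c2 n m) : bool :=
  ev (fun v => tau (e v)) (fun i v w => bin i (e v) (e w)) (fun v w => e v == e w) psi.

Let evG_body j a b : evG (upd (fun=> a) (qvar (theta j)) b) (qbody (theta j)) =
  if b == a then loop j (tau a) else rel j (tau a) (eta a b) (tau b).
Proof.
rewrite /evG; case: eqVneq => [->|neq_ba].
  have updE w : upd (fun=> a) (qvar (theta j)) a w = a by rewrite /upd; case: ifP.
  by apply: ev_ext => [v|i v w|v w]; rewrite /= !updE ?tau_bin ?eqxx.
have neq_ab : a != b by rewrite eq_sym.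
apply: ev_ext => [w|i v w|v w]; rewrite /upd; first by case: ifP.
  by case: ifP; case: ifP => *; rewrite ?tau_bin ?eta_bin ?eta_bin_rev.
by case: v w (qvar (theta j)) => [] [] []; rewrite ?eqxx ?(negPf neq_ab) ?(negPf neq_ba).
Qed.

Let card_evG_body j a :
  #|[set b | evG (upd (fun=> a) (qvar (theta j)) b) (qbody (theta j))]| =
  loop j (tau a) + #|[set b | (b != a) && rel j (tau a) (eta a b) (tau b)]|.
Proof.
rewrite (cardsD1 a) inE evG_body eqxx; congr (_ + _); apply: eq_card => b.
by rewrite !inE evG_body; case: eqP.
Qed.

Let coherent : Prop := forall a j, lab j (tau a) =
  (thr j <= loop j (tau a) + #|[set b | (b != a) && rel j (tau a) (eta a b) (tau b)]|).

Let labelE psi a : coherent -> psi \in qs ->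
  label (tau a) psi = qneg psi (+)
    (qthr psi <= #|[set b | evG (upd (fun=> a) (qvar psi) b) (qbody psi)]|).
Proof.
move=> coh psi_qs; have lt_psi : index psi qs < l by rewrite index_mem.
have thetaE : theta (Ordinal lt_psi) = psi by rewrite /theta nth_index.
have := coh a (Ordinal lt_psi); rewrite -card_evG_body /lab /thr thetaE => <-.
by rewrite addbA addbb.
Qed.

(** Locally correct labels are truth values. By induction the body has the same witnesses under
    [sat] and [evG], and coherence compares the number of the latter with the threshold. *)
Lemma sat_ev_of_coherent : coherent ->
  forall psi e, {subset quantified psi <= qs} -> sat e psi = evG e psi.
Proof.
move=> coh psi e; elim: psi e => //=
  [i v|p IH|p IHp q IHq|p IHp q IHq|v p IH|v p IH|k v p IH] e sub.
- by rewrite -tau_un.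
- by rewrite IH.
- by rewrite IHp ?IHq // => x xs; apply: sub; rewrite mem_cat xs ?orbT.
- by rewrite IHp ?IHq // => x xs; apply: sub; rewrite mem_cat xs ?orbT.
- have p_qs : {subset quantified p <= qs} by move=> x xp; apply: sub; rewrite inE xp orbT.
  rewrite -[LHS]/(sat e (CEx v p)) sat_other_var // sat_quantifier //=.
  rewrite [RHS]labelE //; last by apply: sub; rewrite mem_head.
  by congr (_ <= _); apply: eq_card => a; rewrite !inE IH.
- have p_qs : {subset quantified p <= qs} by move=> x xp; apply: sub; rewrite inE xp orbT.
  rewrite -[LHS]/(sat e (CAll v p)) sat_other_var // sat_quantifier //.
  rewrite [RHS]labelE //; last by apply: sub; rewrite mem_head.
  by congr (_ (+) (_ <= _)); apply: eq_card => a; rewrite !inE /= IH.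
- have p_qs : {subset quantified p <= qs} by move=> x xp; apply: sub; rewrite inE xp orbT.
  rewrite -[LHS]/(sat e (CAtLeast k v p)) sat_other_var // sat_quantifier //=.
  rewrite [RHS]labelE //; last by apply: sub; rewrite mem_head.
  by congr (_ <= _); apply: eq_card => a; rewrite !inE IH.
Qed.

Lemma sat_ev_of_label : (forall a psi, psi \in qs -> label (tau a) psi = sat (fun=> a) psi) ->
  forall psi e, {subset quantified psi <= qs} -> sat e psi = evG e psi.
Proof.
move=> labP psi e; elim: psi e => //= [i v|p IH|p IHp q IHq|p IHp q IHq|v p _|v p _|k v p _] e sub.
- by rewrite -tau_un.
- by rewrite IH.
- by rewrite IHp ?IHq // => x xs; apply: sub; rewrite mem_cat xs ?orbT.
- by rewrite IHp ?IHq // => x xs; apply: sub; rewrite mem_cat xs ?orbT.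
- by rewrite [RHS]labP -?[LHS]/(sat e (CEx v p)) ?sub ?mem_head // sat_other_var.
- by rewrite [RHS]labP -?[LHS]/(sat e (CAll v p)) ?sub ?mem_head // sat_other_var.
- by rewrite [RHS]labP -?[LHS]/(sat e (CAtLeast k v p)) ?sub ?mem_head // sat_other_var.
Qed.

Lemma coherent_of_label : (forall a psi, psi \in qs -> label (tau a) psi = sat (fun=> a) psi) ->
  coherent.
Proof.
move=> labP a j; rewrite -card_evG_body /lab labP // sat_quantifier // addbA addbb /=.
congr (_ <= _); apply: eq_card => b; rewrite !inE; apply: sat_ev_of_label => //.
exact: quantified_qbody.
Qed.

Lemma label_of_coherent : coherent ->
  forall a psi, psi \in qs -> label (tau a) psi = sat (fun=> a) psi.
Proof.
move=> coh a psi psi_qs; rewrite labelE //.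
rewrite sat_quantifier ?(quantified_quantifier psi_qs) //; congr (_ (+) (_ <= _)).
apply: eq_card => b; rewrite !inE sat_ev_of_coherent //.
exact: quantified_qbody psi_qs.
Qed.

End Interpretation.

(* The closure turns the truth of [phi] under all assignments into a label. *)
Lemma finite_model_closure (G : structure n m) :
  finite_model G phi <-> 0 < #|G| /\ forall a : G, sat (fun=> a) closure.
Proof.
rewrite /finite_model; split=> -[G0 Gphi]; split=> //.
  by move=> a; apply/forallP => b; apply/forallP => c; apply: Gphi.
move=> e; have /forallP/(_ (e false))/forallP/(_ (e true)) := Gphi (e false).
have ext : e =1 upd (upd (fun=> e false) false (e false)) true (e true) by case.
by rewrite (sat_ext _ ext).
Qed.

Let closure_qs : closure \in qs. Proof. exact: mem_head. Qed.

Section Spectrum.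

Variables (k : nat) (g : {ffun 'I_n -> bool} * {ffun 'I_m -> bool} -> 'I_k).

Definition atomic (G : structure n m) (a : G) : {ffun 'I_n -> bool} * {ffun 'I_m -> bool} :=
  ([ffun i => un i a], [ffun i => bin i a a]).

(** The map [g] sorts the 1-types into coordinates: a constant map yields the size of the model, an
    enumeration the 1-type cardinality vector. *)
Definition model_form : pform k :=
  spectrum_form binv thr lab rel loop good (fun t : utype => g t.1).

Lemma model_form_existential : existential model_form.
Proof. exact: spectrum_form_existential. Qed.

Lemma model_form_defines : defines model_form (fun v => exists G : structure n m,
  finite_model G phi /\ forall i, #|[set a : G | g (atomic a) == i]| = v i).
Proof.
move=> v; apply: iff_trans (spectrum_form_defines _ _ _ _ _ _ binvK v) _; split.
  move=> [V [tau [eta [[V0 eta_sym tau_good coh] count]]]].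
  (* Loops come from the vertex types, all other pairs from the forward half of the edge type. *)
  pose G := @Structure n m V (fun i a => (tau a).1.1 i)
    (fun i a b => if a == b then (tau a).1.2 i else (eta a b).1 i).
  have binE i (a : G) : (tau a).1.2 i = bin i a a by rewrite /= eqxx.
  have etaE i (a b : G) : a != b -> (eta a b).1 i = bin i a b by rewrite /= => /negPf->.
  have etaE' i (a b : G) : a != b -> (eta a b).2 i = bin i b a.
    by move=> neq; rewrite /= eq_sym (negPf neq) (eta_sym _ _ neq).
  have satE := @label_of_coherent G tau eta (fun _ _ => erefl) binE etaE etaE' coh.
  exists G; split.
    by apply/finite_model_closure; split=> // a; rewrite -satE //; apply: tau_good.
  move=> i; rewrite -count; apply: eq_card => a; rewrite !inE; congr (g _ == _).
  rewrite [RHS]surjective_pairing; congr (_, _); apply/ffunP => x.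
    by rewrite ffunE.
  by rewrite ffunE binE.
move=> [G [/finite_model_closure[G0 Gphi] count]].
pose tau (a : G) : utype := (atomic a, [tuple of map (fun psi => sat (fun=> a) psi) (in_tuple qs)]).
pose eta (a b : G) : btype := ([ffun i => bin i a b], [ffun i => bin i b a]).
have labP (a : G) psi : psi \in qs -> label (tau a) psi = sat (fun=> a) psi.
  move=> psi_qs; transitivity (nth false [seq sat (fun=> a) x | x <- qs] (index psi qs)) => //.
  by rewrite (nth_map closure) ?index_mem // nth_index.
have [tu tb e1 e2] : [/\ forall i a, (tau a).1.1 i = un i a,
    forall i a, (tau a).1.2 i = bin i a a,
    forall i a b, a != b -> (eta a b).1 i = bin i a b
  & forall i a b, a != b -> (eta a b).2 i = bin i b a].
  by split=> *; rewrite ffunE.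
exists G, tau, eta; split; last exact: count.
split=> // [a|]; first by rewrite /good labP.
exact: (coherent_of_label tu tb e1 e2 labP).
Qed.

Lemma psize_model_form : k <= 2 ^ (n + m) ->
  psize model_form <= 2 ^ (2 ^ (44 * (n + m + c2_length phi + 4))).
Proof.
move=> kX; set L := n + m + c2_length phi + 4.
(* [psize_spectrum_form] is applied with [B = 2 ^ (2 * L)], so [B ^ 22] is [2 ^ (44 * L)]. The
   summand 4 in [L] pays for the two quantifiers of [closure]; the factor 2 covers edge types and
   [D <= L * 2 ^ L]. *)
have -> : 44 * L = 2 * L * 22 by lia.
have lenL : c2_length closure <= L by rewrite /L /=; lia.
have lL : l <= L by apply: leq_trans (size_quantified _) lenL.
have pow a b : a <= b -> 2 ^ a <= 2 ^ b by move=> ab; rewrite leq_pexp2l.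
have L2L : L <= 2 ^ L by apply/ltnW/ltn_expl.
rewrite expnM; apply: psize_spectrum_form.
- by rewrite -[1]/(2 ^ 0) ltn_exp2l // /L; lia.
- rewrite !card_prod !card_ffun card_tuple card_bool !card_ord -!expnD; apply: pow.
  by have := size_quantified closure; rewrite -/qs -/l /L /=; lia.
- by rewrite !card_prod !card_ffun card_bool !card_ord -!expnD; apply: pow; rewrite /L; lia.
- by apply: leq_trans lL (leq_trans L2L (pow _ _ _)); lia.
- apply: (@leq_trans (L * 2 ^ L)); last by rewrite mul2n -addnn expnD leq_mul2r L2L orbT.
  apply: (@leq_trans (\sum_(j < l) 2 ^ L)); last first.
    by rewrite sum_nat_const card_ord leq_mul2r lL orbT.
  apply: leq_sum => j _; apply: leq_trans (qthr_quantified (theta_qs j)) (pow _ _ lenL).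
- by apply: leq_trans kX (pow _ _ _); rewrite /L; lia.
Qed.

End Spectrum.

End Encoding.

(** * Eliminating the symbols that do not occur *)

Section Renaming.

Variables (n m : nat).
Implicit Type phi : c2 n m.

Fixpoint unary_symbols phi : seq 'I_n :=
  match phi with
  | CUn i _ => [:: i]
  | CBin _ _ _ | CEq _ _ => [::]
  | CNot p | CEx _ p | CAll _ p | CAtLeast _ _ p => unary_symbols p
  | CAnd p q | COr p q => unary_symbols p ++ unary_symbols q
  end.

Fixpoint binary_symbols phi : seq 'I_m :=
  match phi with
  | CBin i _ _ => [:: i]
  | CUn _ _ | CEq _ _ => [::]
  | CNot p | CEx _ p | CAll _ p | CAtLeast _ _ p => binary_symbols p
  | CAnd p q | COr p q => binary_symbols p ++ binary_symbols q
  end.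

Lemma size_unary_symbols phi : size (unary_symbols phi) <= c2_length phi.
Proof. by elim: phi => //= *; rewrite ?size_cat; lia. Qed.

Lemma size_binary_symbols phi : size (binary_symbols phi) <= c2_length phi.
Proof. by elim: phi => //= *; rewrite ?size_cat; lia. Qed.

Variables (n' m' : nat) (fu : 'I_n -> 'I_n') (fb : 'I_m -> 'I_m').

Fixpoint rename phi : c2 n' m' :=
  match phi with
  | CUn i v => CUn m' (fu i) v
  | CBin i v w => CBin n' (fb i) v w
  | CEq v w => CEq v w
  | CNot p => CNot (rename p)
  | CAnd p q => CAnd (rename p) (rename q)
  | COr p q => COr (rename p) (rename q)
  | CEx v p => CEx v (rename p)
  | CAll v p => CAll v (rename p)
  | CAtLeast k v p => CAtLeast k v (rename p)
  end.

Lemma c2_length_rename phi : c2_length (rename phi) = c2_length phi.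
Proof. by elim: phi => //= [p ->|p -> q ->|p -> q ->|v p ->|v p ->|k v p ->]. Qed.

Lemma sat_rename (D : finType) (U : 'I_n -> pred D) (R : 'I_m -> rel D)
    (U' : 'I_n' -> pred D) (R' : 'I_m' -> rel D) phi (e : var -> D) :
  (forall i a, i \in unary_symbols phi -> U' (fu i) a = U i a) ->
  (forall i a b, i \in binary_symbols phi -> R' (fb i) a b = R i a b) ->
  @sat _ _ (Structure U' R') e (rename phi) = @sat _ _ (Structure U R) e phi.
Proof.
elim: phi e => //= [i v|i v w|p IH|p IHp q IHq|p IHp q IHq|v p IH|v p IH|k v p IH] e UU RR.
- by rewrite UU ?mem_head.
- by rewrite RR ?mem_head.
- by rewrite IH.
- by rewrite IHp ?IHq // => *; rewrite ?UU ?RR // mem_cat; apply/orP; auto.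
- by rewrite IHp ?IHq // => *; rewrite ?UU ?RR // mem_cat; apply/orP; auto.
- by apply: eq_existsb => a; rewrite IH.
- by apply: eq_forallb => a; rewrite IH.
- by congr (_ <= _); apply: eq_card => a; rewrite !inE IH.
Qed.

(** Models are pulled back along [fu] and [fb]. Conversely they are pushed forward, with a symbol
    empty when no occurring symbol is mapped to it. The domain is unchanged both times. *)
Lemma spec_rename phi : {in unary_symbols phi &, injective fu} ->
  {in binary_symbols phi &, injective fb} ->
  forall N, spec (rename phi) N <-> spec phi N.
Proof.
move=> fu_inj fb_inj N; split=> -[[D U R] [[D0 Dphi] DN]].
  exists (@Structure n m D (fun i => U (fu i)) (fun i => R (fb i))); split=> //; split=> // e.
  by rewrite -(@sat_rename D _ _ U R).
pose U' j (a : D) := [exists i, [&& i \in unary_symbols phi, fu i == j & U i a]].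
pose R' j (a b : D) := [exists i, [&& i \in binary_symbols phi, fb i == j & R i a b]].
exists (@Structure n' m' D U' R'); split=> //; split=> // e.
rewrite (@sat_rename D U R U' R') // => [i a ui|i a b bi].
  apply/existsP/idP => [[i' /and3P[ui' /eqP eqi Ua]]|Ua]; last by exists i; rewrite ui eqxx.
  by rewrite -(fu_inj _ _ ui' ui eqi).
apply/existsP/idP => [[i' /and3P[bi' /eqP eqi Ra]]|Ra]; last by exists i; rewrite bi eqxx.
by rewrite -(fb_inj _ _ bi' bi eqi).
Qed.

End Renaming.

(** The successor keeps the ordinal type nonempty, as [inord] requires, even when no symbol
    occurs. *)
Lemma inord_index_inj (T : eqType) (s : seq T) :
  {in s &, injective (fun x => inord (index x s) : 'I_(size s).+1)}.
Proof.
move=> x y xs ys /(congr1 val); rewrite /= !inordK ?ltnS ?index_size // => eq_index.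
by rewrite -(nth_index x xs) eq_index nth_index.
Qed.

Section Literals.

Variables (n m : nat).

Definition literals (t : {ffun 'I_n -> bool} * {ffun 'I_m -> bool}) : {set literal n m} :=
  [set l | match l.1 with inl i => t.1 i == l.2 | inr i => t.2 i == l.2 end].

(** One sign is chosen for every atom, so any further literal contradicts the opposite one already
    present. *)
Lemma onetype_literals t : onetype (literals t).
Proof.
apply/maxsetP; split=> [|S /forallP S_ok sub].
  by apply/forallP => -[i|i]; rewrite !inE /=; case: (_ i).
apply/eqP; rewrite eqEsubset sub andbT; apply/subsetP => -[p b] pS.
have : ~~ ((p, ~~ b) \in literals t).
  by apply: contraL (S_ok p) => /(subsetP sub); case: b pS => /= -> ->.
by rewrite !inE /=; case: p {pS} => i; case: (_ i) b => [] [].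
Qed.

Lemma onetype_of_atomic (G : structure n m) (a : G) : onetype_of a = literals (atomic a).
Proof. by apply/setP => -[[i|i] b]; rewrite !inE /= ffunE. Qed.

End Literals.

(** Renaming first leaves at most [2 * c2_length phi + 2] symbols, which makes the bound independent
    of [n] and [m]. *)
Lemma spec_form_exists n m (phi : c2 n m) : exists f : pform 1,
  [/\ existential f, defines f (as_vectors (spec phi))
    & psize f <= 2 ^ (2 ^ (44 * (3 * c2_length phi + 6)))].
Proof.
pose fu (i : 'I_n) : 'I_(size (unary_symbols phi)).+1 := inord (index i (unary_symbols phi)).
pose fb (i : 'I_m) : 'I_(size (binary_symbols phi)).+1 := inord (index i (binary_symbols phi)).
exists (model_form (rename fu fb phi) (fun=> ord0)); split.
- exact: model_form_existential.
- move=> v; apply: iff_trans (model_form_defines _ _ v) _.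
  apply: iff_trans (spec_rename (@inord_index_inj _ _) (@inord_index_inj _ _) _).
  split=> -[G [Gphi GN]]; exists G; split=> //.
    by rewrite -GN; apply: eq_card => a; rewrite !inE eqxx.
  by move=> i; rewrite (ord1 i) -GN; apply: eq_card => a; rewrite !inE eqxx.
apply: leq_trans (psize_model_form _ _ _) _; first by rewrite expn_gt0.
rewrite !leq_pexp2l // c2_length_rename leq_mul2l /=.
have := size_unary_symbols phi; have := size_binary_symbols phi; lia.
Qed.

(** The map [g] sends a truth assignment to the index of its 1-type: surjectivity of [pi] gives an
    index, and injectivity makes it the only one. *)
Lemma Pi_spec_form_exists n m (pi : 'I_(2 ^ (n + m)) -> {set literal n m}) (phi : c2 n m) :
  onetype_enum pi -> exists f : pform (2 ^ (n + m)),
  [/\ existential f, defines f (Pi_spec pi phi)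
    & psize f <= 2 ^ (2 ^ (44 * (n + m + c2_length phi + 4)))].
Proof.
move=> [pi_inj piP]; have ex_pi t : exists i, pi i == literals t.
  by have [i <-] := (piP _).1 (onetype_literals t); exists i.
pose g t := xchoose (ex_pi t); have gP t i : (g t == i) = (literals t == pi i).
  by rewrite -(eqP (xchooseP (ex_pi t))) (inj_eq pi_inj).
exists (model_form phi g); split.
- exact: model_form_existential.
- move=> v; apply: iff_trans (model_form_defines _ _ v) _.
  by split=> -[G [Gphi count]]; exists G; split=> // i; rewrite -count;
    apply: eq_card => a; rewrite !inE gP onetype_of_atomic.
exact: psize_model_form.
Qed.

Theorem theorem26 :
  (forall (n m : nat) (pi : 'I_(2 ^ (n + m)) -> {set literal n m})
          (phi : c2 n m),
      onetype_enum pi -> sentence phi ->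
      semilinear (as_vectors (spec phi)) /\ semilinear (Pi_spec pi phi))
  /\
  (exists c : nat,
    forall (n m : nat) (pi : 'I_(2 ^ (n + m)) -> {set literal n m})
           (phi : c2 n m),
      onetype_enum pi -> sentence phi ->
      (exists f : pform 1,
          [/\ existential f,
              defines f (as_vectors (spec phi))
            & psize f <= doubly_exp c (c2_length phi)]) /\
      (exists g : pform (2 ^ (n + m)),
          [/\ existential g,
              defines g (Pi_spec pi phi)
            & psize g <= doubly_exp c (c2_length phi + n + m)])).
Proof.
split=> [n m pi phi piP _|].
  have [f [_ f_def _]] := spec_form_exists phi.
  by have [g [_ g_def _]] := Pi_spec_form_exists phi piP; split; [exists f | exists g].
have bound a L : 0 < L -> a <= 400 * L -> 2 ^ (2 ^ a) <= doubly_exp 400 L.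
  move=> L0 aL; rewrite /doubly_exp !leq_pexp2l //; apply: leq_trans aL _.
  by rewrite leq_mul2l -[leqLHS]expn1 leq_pexp2l.
(* For [L > 0], [44 * (3 * L + 6)] is at most [396 * L], and [44 * (L + 4)] at most [220 * L]. *)
exists 400 => n m pi phi piP _.
have len : 0 < c2_length phi by case: phi.
have [f [f_ex f_def f_size]] := spec_form_exists phi.
have [g [g_ex g_def g_size]] := Pi_spec_form_exists phi piP.
split; [exists f | exists g]; split=> //.
  by apply: leq_trans f_size (bound _ _ _ _) => //; lia.
by apply: leq_trans g_size (bound _ _ _ _); lia.
Qed.
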